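(* Let $N=2$ and let $\Omega=B(R)\subset\mathbb{R}^2$ or $\Omega=\mathbb{R}^2$. Let $u$ be a radially symmetric solution of $$u_t=\Delta u+e^u\ (x\in\Omega,\ t>0),\qquad u=0\ (x\in\partial\Omega,\ t>0),\qquad u(x,0)=u_0(x)\ge0\ (x\in\Omega),$$ and assume that $u(0,t)=\max_x u(x,t)$. If $u$ blows up at $t=T<\infty$, then the blow-up is of type I.
   Context: $B(R)=\{x\in\mathbb{R}^2:|x|<R\}$; the initial function $u_0$ is nonnegative and in $C^1(\overline\Omega)$; when $\Omega=\mathbb{R}^2$ the boundary condition is void. The solution is classical on $(0,T)$, and the condition $u(0,t)=\max_x u(x,t)$ is for every $t\in(0,T)$. Blow-up at $t=T\in(0,\infty)$ means $\|u(\cdot,t)\|_\infty<\infty$ for $t<T$ and $\limsup_{t\to T}\|u(\cdot,t)\|_\infty=\infty$. Blow-up is of type I if there are constants $C_1,C_2$ with $C_1\le\log(T-t)+\|u(\cdot,t)\|_\infty\le C_2$ for every $t\in(0,T)$. *)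

(* Defs.v *)
(* MathComp-Analysis over an abstract [R : realType]. *)
From HB Require Import structures.
From mathcomp Require Import all_boot all_order all_algebra.
From mathcomp Require Import all_classical all_reals all_analysis.
Set Implicit Arguments.
Unset Strict Implicit.
Unset Printing Implicit Defensive.
Import Order.TTheory GRing.Theory Num.Theory.
Import numFieldNormedType.Exports.
Local Open Scope classical_set_scope.
Local Open Scope ring_scope.

(* The library norm on row vectors is the max norm, hence a separate
   Euclidean norm; both induce the same topology. *)
Definition enorm (R : realType) (n : nat) (x : 'rV[R]_n) : R :=
  Num.sqrt (\sum_(i < n) x 0 i ^+ 2).

Definition eball (R : realType) (n : nat) (r : R) : set 'rV[R]_n :=
  [set x | enorm x < r].

Definition boundary (T : topologicalType) (A : set T) : set T :=
  closure A `\` A°.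

Definition partial (R : realType) (n : nat) (i : 'I_n.+1)
    (f : 'rV[R]_n.+1 -> R) (x : 'rV[R]_n.+1) : R :=
  'D_(delta_mx 0 i) f x.

Definition has_partial (R : realType) (n : nat) (i : 'I_n.+1)
    (f : 'rV[R]_n.+1 -> R) (x : 'rV[R]_n.+1) : Prop :=
  derivable f x (delta_mx 0 i).

Definition laplacian (R : realType) (n : nat)
    (f : 'rV[R]_n.+1 -> R) (x : 'rV[R]_n.+1) : R :=
  \sum_(i < n.+1) partial i (partial i f) x.

(* [f] is C^1 on the closure of the open set [D]: [f] is continuous there, and
   its first partial derivatives in [D] extend continuously to the closure. *)
Definition C1_closure (R : realType) (n : nat) (D : set 'rV[R]_n.+1)
    (f : 'rV[R]_n.+1 -> R) : Prop :=
  {within closure D, continuous f} /\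
  forall i : 'I_n.+1,
    (forall x, D x -> has_partial i f x) /\
    exists2 g : 'rV[R]_n.+1 -> R, {within closure D, continuous g} &
      forall x, D x -> g x = partial i f x.

(* [u x t] is C^{2,1} on [D] x (0,T): u_t and all spatial partial derivatives
   of order at most 2 exist and are jointly continuous; joint continuity
   of [u] itself is the case with no derivative. *)
Definition C21 (R : realType) (n : nat) (D : set 'rV[R]_n.+1) (T : R)
    (u : 'rV[R]_n.+1 -> R -> R) : Prop :=
  let Q : set ('rV[R]_n.+1 * R) := D `*` [set` `]0, T[] in
  [/\ {within Q, continuous (fun z => u z.1 z.2)},
      (forall x t, Q (x, t) -> derivable (u x) t 1) /\
      {within Q, continuous (fun z => derive1 (u z.1) z.2)},
      forall i : 'I_n.+1,
        (forall x t, Q (x, t) -> has_partial i (u ^~ t) x) /\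
        {within Q, continuous (fun z => partial i (u ^~ z.2) z.1)}
    & forall i j : 'I_n.+1,
        (forall x t, Q (x, t) -> has_partial j (partial i (u ^~ t)) x) /\
        {within Q, continuous
          (fun z => partial j (partial i (u ^~ z.2)) z.1)}].

(* Classical solution on (0,T) of
     u_t = Lap u + e^u in D, u = 0 on the boundary of D, u(.,0) = u0.
   Since u0 is not required to vanish on the boundary, continuity is not imposed
   at the corner (boundary of D) x {0}; there u is only required to be
   locally bounded.  The values of [u] outside closure D x [0,T) are
   irrelevant. *)
Definition classical_solution (R : realType) (n : nat) (D : set 'rV[R]_n.+1)
    (T : R) (u0 : 'rV[R]_n.+1 -> R) (u : 'rV[R]_n.+1 -> R -> R) : Prop :=
  [/\ C21 D T u /\
      {within ((closure D `*` [set` `]0, T[]) `|` (D `*` [set` `[0, T[])),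
        continuous (fun z : 'rV[R]_n.+1 * R => u z.1 z.2)},
      forall r tau, tau < T -> exists M, forall x t,
        D x -> enorm x <= r -> 0 < t <= tau -> `|u x t| <= M,
      forall x t, D x -> 0 < t < T ->
        derive1 (u x) t = laplacian (u ^~ t) x + expR (u x t),
      forall x t, boundary D x -> 0 < t < T -> u x t = 0
    & forall x, D x -> u x 0 = u0 x].

Definition radial (R : realType) (n : nat) (D : set 'rV[R]_n)
    (f : 'rV[R]_n -> R) : Prop :=
  forall x y, D x -> D y -> enorm x = enorm y -> f x = f y.

Definition supnorm (R : realType) (X : Type) (D : set X) (f : X -> R) : \bar R :=
  ereal_sup [set (`|f x|)%:E | x in D].

Definition blows_up_at (R : realType) (X : Type) (D : set X) (T : R)
    (u : X -> R -> R) : Prop :=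
  (forall t, 0 <= t < T -> (supnorm D (u ^~ t) < +oo)%E) /\
  limf_esup (fun t => supnorm D (u ^~ t)) (T^'-) = +oo%E.

Definition type_I (R : realType) (X : Type) (D : set X) (T : R)
    (u : X -> R -> R) : Prop :=
  exists C1 C2 : R, forall t, 0 < t < T ->
    (C1%:E <= (ln (T - t))%:E + supnorm D (u ^~ t) <= C2%:E)%E.

(* Main.v *)
Require Import Defs.
From HB Require Import structures.
From mathcomp Require Import all_boot all_order all_algebra.
From mathcomp Require Import all_classical all_reals all_analysis.
From mathcomp Require Import ring lra.
Set Implicit Arguments.
Unset Strict Implicit.
Unset Printing Implicit Defensive.
Import Order.TTheory GRing.Theory Num.Theory.
Import numFieldNormedType.Exports.
Local Open Scope classical_set_scope.
Local Open Scope ring_scope.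

(** Let [M t] stand for [u 0 t], the spatial maximum.  Type I blow-up says that
[exp (- M t)] and [T - t] are comparable; everything below is derived from the
maximum principle for twice differentiable functions.

One inequality is immediate: at a spatial maximum the Laplacian is
nonpositive, hence [M' <= exp M] and [exp (- M t) + t] is nondecreasing
([max_growth_le]).  As [M] is unbounded near [T], [exp (- M t) <= T - t].

The other inequality rests on a feature of dimension two: the stationary
solutions [bubble al x = al - 2 ln (1 + exp al |x|^2 / 8)], one for each height
[al], tend to minus infinity away from the origin as [al] grows.  Fix a time
[t0] and a small ball.  If [al] is large, the bubble is below [u] on the
boundary of the ball at all later times, and at time [t0] it is so steep that
[u - bubble al] is nondecreasing in [|x|].  A maximum principle for pairs of
points [|x| <= |y|] shows that at later times the positive part of
[u - bubble al] still lies outside its negative part ([crossing_ordered]): a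
sign pattern from plus to minus, going outwards, never appears.  Taking [x = 0],
as soon as [M t >= al] the whole bubble of height [al] is below [u], and it
stays there ([bubble_persists]).

Now let [A = M t] be large.  The solution lies above the bubble of height [A],
and also above the lower but wider bubble of height [A - ln 4].  On the circle
[|x|^2 = 32 exp (- A)] the latter exceeds the former by the fixed amount
[2 ln (5/4)].  Therefore [u - bubble A] is a nonnegative supersolution of the
heat equation in that disc with boundary values at least [2 ln (5/4)], and
after the time [32 exp (- A)] a fixed fraction of this has reached the centre:
[M (t + 32 exp (- M t)) >= M t + bubble_step] ([bubble_gain]).  Iterating, the
waiting times form a geometric series, and blow-up happens no later than a
constant times [exp (- M t)] after [t] ([rate_from_gain]).

All this needs [u] to be bounded below, which is also what lets [M] control the
supremum norm.  On a disc this is comparison with a constant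
([ball_lower_bound]).  On the whole plane no growth condition at infinity is
given uniformly in time, and the argument is the one behind the uniqueness of
nonnegative solutions of the heat equation.  If [u <= K] up to some time, then
[K - u] is nonnegative, so its time integral can only increase.  A large value
of that integral on a circle would therefore be felt at the origin, which gives
a Gaussian bound ([gap_growth]).  For functions of such growth the
Phragmen-Lindelof principle holds on short time intervals
([gauss_comparison]), and it yields [u >= 0] ([entire_nonneg]). *)

(** * Derivatives of real functions *)

Section real_derivatives.
Context {R : realType}.
Implicit Types (f g : R -> R) (x a b k : R).

Lemma derD f g x a b : is_derive x 1 f a -> is_derive x 1 g b ->
  is_derive x 1 (fun y => f y + g y) (a + b).
Proof. exact: is_deriveD. Qed.

Lemma derN f x a : is_derive x 1 f a -> is_derive x 1 (fun y => - f y) (- a).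
Proof. exact: is_deriveN. Qed.

Lemma derB f g x a b : is_derive x 1 f a -> is_derive x 1 g b ->
  is_derive x 1 (fun y => f y - g y) (a - b).
Proof. exact: is_deriveB. Qed.

Lemma derM f g x a b : is_derive x 1 f a -> is_derive x 1 g b ->
  is_derive x 1 (fun y => f y * g y) (f x * b + g x * a).
Proof. exact: is_deriveM. Qed.

Lemma derZ f x k a : is_derive x 1 f a ->
  is_derive x 1 (fun y => k * f y) (k * a).
Proof. exact: is_deriveZ. Qed.

Lemma der_id x : is_derive x 1 (fun y : R => y) 1.
Proof. exact: is_derive_id. Qed.

Lemma der_cst k x : is_derive x 1 (fun _ : R => k) 0.
Proof. exact: is_derive_cst. Qed.

Lemma der_comp f g x a b : is_derive (g x) 1 f a -> is_derive x 1 g b ->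
  is_derive x 1 (fun y => f (g y)) (a * b).
Proof. exact: is_derive1_comp. Qed.

Lemma der_exp f x a : is_derive x 1 f a ->
  is_derive x 1 (fun y => expR (f y)) (expR (f x) * a).
Proof. by apply: der_comp; exact: is_derive_expR. Qed.

Lemma der_ln f x a : 0 < f x -> is_derive x 1 f a ->
  is_derive x 1 (fun y => ln (f y)) ((f x)^-1 * a).
Proof. by move=> fx; apply: der_comp; exact: is_derive1_ln. Qed.

Lemma der_inv f x a : f x != 0 -> is_derive x 1 f a ->
  is_derive x 1 (fun y => (f y)^-1) (- (f x ^- 2) * a).
Proof. by move=> fx fa; exact: is_deriveV. Qed.

Lemma der_eq f x a b : is_derive x 1 f a -> a = b -> is_derive x 1 f b.
Proof. by move=> + <-. Qed.

Lemma der_continuous f x a : is_derive x 1 f a -> {for x, continuous f}.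
Proof. by move=> [/derivable1_diffP/differentiable_continuous]. Qed.

End real_derivatives.

(** * Laplacians along coordinate lines *)

Definition is_d2 (R : realType) (g : R -> R) (a : R) : Prop :=
  exists2 D : R -> R, (\forall h \near (0:R), is_derive (h:R) (1:R) g (D h)) &
    is_derive (0 : R) (1:R) D a.

Definition line (R : realType) (n : nat) (f : 'rV[R]_n.+1 -> R)
    (x : 'rV[R]_n.+1) (i : 'I_n.+1) (h : R) : R :=
  f (h *: delta_mx 0 i + x).

(** [l] is the sum of the second derivatives of [f] at [x] along the coordinate
    lines.  As a relation it is additive without any side condition, so the
    Laplacian of a difference with an explicit barrier is read off termwise. *)
Definition is_lap (R : realType) (n : nat) (f : 'rV[R]_n.+1 -> R)
    (x : 'rV[R]_n.+1) (l : R) : Prop :=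
  exists2 a : 'I_n.+1 -> R, (forall i, is_d2 (line f x i) (a i)) &
    l = \sum_(i < n.+1) a i.

Lemma is_derive_gt0 (R : realType) (f : R -> R) (x d : R) :
  is_derive x 1 f d -> 0 < d ->
  exists2 e : R, 0 < e & forall h : R, 0 < h < e -> f (x - h) < f x < f (x + h).
Proof.
move=> [cf fd] d0.
have {}cf : h^-1 *: (f (h *: 1 + x) - f x) @[h --> 0^'] --> d.
  by move: fd; rewrite /derive => <-.
move: cf; move/cvgrPdist_lt => /(_ _ d0) /nbhs_ballP [e /= e0 be].
exists e => // h /andP[h0 he].
have hp : h != 0 by rewrite gt_eqF.
have := be h; rewrite /ball /= sub0r normrN gtr0_norm// => /(_ he hp).
have := be (- h); rewrite /ball /= sub0r opprK gtr0_norm// oppr_eq0 => /(_ he hp).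
rewrite /GRing.scale /= !mulr1 invrN mulNr !ltr_norml => /andP[_ H1] /andP[_ H2].
have {}H2 : 0 < h^-1 * (f (h + x) - f x) by lra.
have {}H1 : h^-1 * (f (- h + x) - f x) < 0 by lra.
move: H1 H2; rewrite pmulr_rlt0 ?invr_gt0// pmulr_rgt0 ?invr_gt0//.
by rewrite [x - h]addrC [x + h]addrC; lra.
Qed.

Lemma is_derive_lt0 (R : realType) (f : R -> R) (x d : R) :
  is_derive x 1 f d -> d < 0 ->
  exists2 e : R, 0 < e & forall h : R, 0 < h < e -> f (x + h) < f x < f (x - h).
Proof.
move=> fd d0; have fN : is_derive x 1 (- f) (- d) by exact: is_deriveN.
have [|e e0 H] := is_derive_gt0 fN; first by rewrite oppr_gt0.
by exists e => // h /H; rewrite !fctE !ltrN2 andbC.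
Qed.

Lemma is_derive_min_left (R : realType) (f : R -> R) (t d s : R) :
  is_derive t 1 f d -> s < t ->
  (forall r, s < r < t -> f t <= f r) -> d <= 0.
Proof.
move=> fd st H; rewrite leNgt; apply/negP => /(is_derive_gt0 fd)[e e0 He].
pose h := Num.min (e / 2) ((t - s) / 2).
have h0 : 0 < h by rewrite lt_min !divr_gt0 ?subr_gt0.
have he : h < e by rewrite gt_min; apply/orP; left; lra.
have hs : h < t - s by rewrite gt_min; apply/orP; right; lra.
have := H (t - h); have := He h; rewrite h0 he => /(_ isT) /andP[h1 _].
by move=> /(_ ltac:(lra)); lra.
Qed.

Lemma is_d2_min (R : realType) (g : R -> R) (a : R) :
  is_d2 g a -> (\forall h \near (0:R), g 0 <= g h) -> 0 <= a.
Proof.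
move=> [D gD Da] gmin; rewrite leNgt; apply/negP => a0.
have [e1 e10 H1] := is_derive_lt0 Da a0.
move/nbhs_ballP : gD => [e2 /= e20 H2].
move/nbhs_ballP : gmin => [e3 /= e30 H3].
have H2' (h : R) : `|h| < e2 -> is_derive h 1 g (D h).
  by move=> he; apply: H2; rewrite /ball /= sub0r normrN.
have H3' (h : R) : `|h| < e3 -> g 0 <= g h.
  by move=> he; apply: H3; rewrite /ball /= sub0r normrN.
have gD0 : is_derive (0 : R) 1 g (D 0) by apply: H2'; rewrite normr0.
have D0 : D 0 = 0.
  apply/eqP; rewrite eq_le; apply/andP; split; rewrite leNgt; apply/negP => Dn.
    have [e e0 /(_ (Num.min (e / 2) (e3 / 2)))] := is_derive_gt0 gD0 Dn.
    have m0 : 0 < Num.min (e / 2) (e3 / 2) by rewrite lt_min !divr_gt0.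
    have m1 : Num.min (e / 2) (e3 / 2) < e by rewrite gt_min; apply/orP; left; lra.
    have m2 : Num.min (e / 2) (e3 / 2) < e3 by rewrite gt_min; apply/orP; right; lra.
    rewrite m0 m1 => /(_ isT)/andP[+ _].
    by rewrite ltNge sub0r H3'// normrN gtr0_norm.
  have [e e0 /(_ (Num.min (e / 2) (e3 / 2)))] := is_derive_lt0 gD0 Dn.
  have m0 : 0 < Num.min (e / 2) (e3 / 2) by rewrite lt_min !divr_gt0.
  have m1 : Num.min (e / 2) (e3 / 2) < e by rewrite gt_min; apply/orP; left; lra.
  have m2 : Num.min (e / 2) (e3 / 2) < e3 by rewrite gt_min; apply/orP; right; lra.
  rewrite m0 m1 => /(_ isT)/andP[+ _].
  by rewrite ltNge add0r H3'// gtr0_norm.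
pose h := Num.min (e1 / 2) (Num.min (e2 / 2) (e3 / 2)).
have h0 : 0 < h by rewrite !lt_min !divr_gt0.
have he1 : h < e1 by rewrite gt_min; apply/orP; left; lra.
have he2 : h < e2 by rewrite !gt_min; apply/orP; right; apply/orP; left; lra.
have he3 : h < e3 by rewrite !gt_min; apply/orP; right; apply/orP; right; lra.
have gh : forall x : R, x \in `]0, h[ -> is_derive x 1 g (D x).
  move=> x; rewrite in_itv/= => /andP[x0 xh]; apply: H2'.
  by rewrite gtr0_norm//; lra.
have gc : {within `[0, h], continuous g}.
  apply: derivable_within_continuous => x; rewrite in_itv/= => /andP[x0 xh].
  have xe : `|x| < e2 by rewrite ger0_norm//; lra.
  by have [] := H2' _ xe.
have [c + gch] := MVT h0 gh gc; rewrite in_itv/= => /andP[c0 ch].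
have : g 0 <= g h by apply: H3'; rewrite gtr0_norm.
have := H1 c; rewrite c0 (lt_trans ch)//= add0r D0 => /(_ isT)/andP[Dc _].
have : D c * (h - 0) < 0 by rewrite subr0 pmulr_llt0.
lra.
Qed.

Lemma is_d2N (R : realType) (g : R -> R) (a : R) : is_d2 g a -> is_d2 (- g) (- a).
Proof.
move=> [D gD Da]; exists (- D); last exact: is_deriveN.
near=> h; have gh : is_derive (h : R) 1 g (D h) by near: h.
exact: is_deriveN.
Unshelve. all: by end_near. Qed.

Lemma is_d2D (R : realType) (f g : R -> R) (a b : R) :
  is_d2 f a -> is_d2 g b -> is_d2 (f + g) (a + b).
Proof.
move=> [D gD Da] [E fE Eb]; exists (D + E); last exact: is_deriveD.
near=> h; have gh : is_derive (h : R) 1 f (D h) by near: h.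
have fh : is_derive (h : R) 1 g (E h) by near: h.
exact: is_deriveD.
Unshelve. all: by end_near. Qed.

Lemma is_d2Z (R : realType) (g : R -> R) (k a : R) :
  is_d2 g a -> is_d2 (k \*: g) (k * a).
Proof.
move=> [D gD Da]; exists (k \*: D); last exact: is_deriveZ.
near=> h; have gh : is_derive (h : R) 1 g (D h) by near: h.
by apply: is_deriveZ.
Unshelve. all: by end_near. Qed.

Lemma is_d2_cst (R : realType) (k : R) : is_d2 (cst k) 0.
Proof.
exists (cst 0); last exact: is_derive_cst.
by near=> h; exact: is_derive_cst.
Unshelve. all: by end_near. Qed.

Lemma is_lapD (R : realType) n (f g : 'rV[R]_n.+1 -> R) x (a b : R) :
  is_lap f x a -> is_lap g x b -> is_lap (fun y => f y + g y) x (a + b).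
Proof.
move=> [c fc ->] [d gd ->]; exists (fun i => c i + d i); last first.
  by rewrite big_split.
by move=> i; exact: (is_d2D (fc i) (gd i)).
Qed.

Lemma is_lapZ (R : realType) n (f : 'rV[R]_n.+1 -> R) x (k a : R) :
  is_lap f x a -> is_lap (fun y => k * f y) x (k * a).
Proof.
move=> [c fc ->]; exists (fun i => k * c i); last by rewrite mulr_sumr.
by move=> i; exact: (is_d2Z k (fc i)).
Qed.

Lemma is_lapN (R : realType) n (f : 'rV[R]_n.+1 -> R) x (a : R) :
  is_lap f x a -> is_lap (fun y => - f y) x (- a).
Proof.
move=> [c fc ->]; exists (fun i => - c i); last by rewrite sumrN.
by move=> i; exact: (is_d2N (fc i)).
Qed.

Lemma is_lapB (R : realType) n (f g : 'rV[R]_n.+1 -> R) x (a b : R) :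
  is_lap f x a -> is_lap g x b -> is_lap (fun y => f y - g y) x (a - b).
Proof. by move=> fa gb; exact: (is_lapD fa (is_lapN gb)). Qed.

Lemma is_lap_cst (R : realType) n (k : R) (x : 'rV[R]_n.+1) :
  is_lap (fun=> k) x 0.
Proof.
by exists (fun=> 0); [move=> i; exact: is_d2_cst | rewrite big1].
Qed.

Lemma line_continuous (R : realType) n (x : 'rV[R]_n.+1) (i : 'I_n.+1) :
  continuous (fun h : R => h *: (delta_mx 0 i : 'rV[R]_n.+1) + x).
Proof.
move=> h; apply: cvgD; last exact: cvg_cst.
exact: scalel_continuous.
Qed.

Lemma near_line (R : realType) n (x : 'rV[R]_n.+1) (i : 'I_n.+1)
    (P : 'rV[R]_n.+1 -> Prop) :
  (\forall y \near x, P y) -> \forall h \near (0 : R), P (h *: delta_mx 0 i + x).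
Proof.
move=> Px; have := @line_continuous R n x i 0; apply.
by rewrite /= scale0r add0r.
Qed.

Lemma is_lap_min (R : realType) n (f : 'rV[R]_n.+1 -> R) x (l : R) :
  is_lap f x l -> (\forall y \near x, f x <= f y) -> 0 <= l.
Proof.
move=> [a fa ->] fmin; apply: sumr_ge0 => i _; apply: is_d2_min (fa i) _.
by rewrite /line scale0r add0r; exact: (near_line i fmin).
Qed.

Lemma is_lap_max (R : realType) n (f : 'rV[R]_n.+1 -> R) x (l : R) :
  is_lap f x l -> (\forall y \near x, f y <= f x) -> l <= 0.
Proof.
move=> /is_lapN fl fmax; rewrite -oppr_ge0; apply: is_lap_min fl _.
by move: fmax; apply: filterS => y; rewrite lerN2.
Qed.

(** * First touching times *)

Definition sq (R : realType) (n : nat) (x : 'rV[R]_n) : R :=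
  \sum_(i < n) x 0 i ^+ 2.

Definition cball (R : realType) (n : nat) (r : R) : set 'rV[R]_n :=
  [set x | sq x <= r].

Lemma sq_ge0 (R : realType) n (x : 'rV[R]_n) : 0 <= sq x.
Proof. by apply: sumr_ge0 => i _; exact: sqr_ge0. Qed.

Lemma sq_continuous (R : realType) n : continuous (@sq R n).
Proof.
apply: continuous_big => [|i _ x]; first exact: add_continuous.
have c := @coord_continuous R 1 n 0 i x.
exact: (cvgM c c).
Qed.

Lemma coord_le_sq (R : realType) n (x : 'rV[R]_n) i : x 0 i ^+ 2 <= sq x.
Proof.
rewrite /sq (bigD1 i)//= lerDl; apply: sumr_ge0 => j _; exact: sqr_ge0.
Qed.

Lemma cball_compact (R : realType) n (r : R) : compact (@cball R n r).
Proof.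
have cK : compact [set v : 'rV[R]_n | forall i, v ord0 i \in `[- (1 + r), 1 + r]].
  by apply: (@rV_compact _ _ (fun=> `[- (1 + r), 1 + r]%classic)) => _;
    exact: segment_compact.
apply: subclosed_compact cK _.
  by apply: (closed_comp _ (@closed_le _ r)) => x _; exact: sq_continuous.
move=> x xr i; have := le_trans (coord_le_sq x i) xr.
by rewrite in_itv/= => H; apply/andP; split; nra.
Qed.

(** The times at which [z] fails to be positive somewhere form the projection of a
    compact set, so there is a first one.  Positivity before that time and
    continuity give equality at the touching point and [0 <= z] everywhere else. *)
Lemma first_touch (R : realType) (X : topologicalType) (K : set X) (t1 t2 : R)
    (z : X -> R -> R) :
  compact K ->
  {within K `*` `[t1, t2]%classic, continuous (fun p => z p.1 p.2)} ->
  (forall x, K x -> 0 < z x t1) ->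
  (exists x t, [/\ K x, t1 <= t <= t2 & z x t <= 0]) ->
  exists x t, [/\ K x, t1 < t <= t2, z x t = 0,
    forall y s, K y -> t1 <= s < t -> 0 < z y s &
    forall y, K y -> 0 <= z y t].
Proof.
move=> cK cz z1 [x0 [s0 [Kx0 s0t zx0]]].
pose A := K `*` `[t1, t2]%classic.
have cA : compact A by apply: compact_setX => //; exact: segment_compact.
have /continuous_closedP/(_ _ (@closed_le _ (0 : R)))/closed_subspaceP[V cV VA] := cz.
have cAV : compact (A `&` V) by exact: compact_closedI.
have AVE p : (A `&` V) p <-> A p /\ z p.1 p.2 <= 0.
  split=> -[Ap Hp]; split=> //.
    by have : (V `&` A) p by []; rewrite VA => -[].
  by have [] : (V `&` A) p by rewrite VA; split.
have [||p] := @compact_EVT_min _ R (fun p : X * R => p.2) _ _ cAV.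
- by exists (x0, s0); apply/AVE; split => //; split => //=; rewrite in_itv.
- by apply: continuous_subspaceT => p; exact: (@cvg_snd _ _ (nbhs p.1) (nbhs p.2)).
rewrite inE => /AVE[[Kp /=]]; rewrite in_itv/= => /andP[p1 p2] zp pmin.
have before y s : K y -> t1 <= s < p.2 -> 0 < z y s.
  move=> Ky /andP[s1 sp]; rewrite ltNge; apply/negP => zys.
  have := pmin (y, s); rewrite inE => H.
  have : p.2 <= s.
    apply: H; apply/AVE; split => //; split => //=.
    by rewrite in_itv/= s1 (ltW (lt_le_trans sp p2)).
  by rewrite leNgt sp.
have p1' : t1 < p.2.
  rewrite lt_neqAle p1 andbT; apply/eqP => E.
  by have := z1 _ Kp; rewrite E ltNge zp.
have at_p y : K y -> 0 <= z y p.2.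
  move=> Ky; rewrite leNgt; apply/negP => zy.
  have Ay : A (y, p.2) by split => //=; rewrite in_itv/= p1.
  have := cz; rewrite subspace_continuousP => /(_ _ Ay) /cvgr_lt /(_ _ zy).
  rewrite /= => -[[B C] /= [By Cp]] BC.
  have [s [Cs s1 sp]] : exists s, [/\ C s, t1 <= s & s < p.2].
    move/nbhs_ballP : Cp => [e /= e0 Ce].
    pose h := Num.min (e / 2) ((p.2 - t1) / 2).
    have h0 : 0 < h by rewrite lt_min !divr_gt0 ?subr_gt0.
    have he : h < e by rewrite gt_min; apply/orP; left; lra.
    have hs : h < p.2 - t1 by rewrite gt_min; apply/orP; right; lra.
    exists (p.2 - h); split; [apply: Ce|lra|lra].
    by rewrite /ball /= opprB addrC subrK gtr0_norm.
  have := before _ _ Ky (introT andP (conj s1 sp)); rewrite ltNge => /negP; apply.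
  apply: ltW; apply: (BC (y, s)) => //=.
    by split => //=; exact: nbhs_singleton.
  by split => //=; rewrite in_itv/= s1 (ltW (lt_le_trans sp p2)).
exists p.1, p.2; split => //; first by rewrite p1'.
by apply/eqP; rewrite eq_le zp at_p.
Qed.

Lemma is_derive_line (R : realType) n (f : 'rV[R]_n.+1 -> R) x i (h : R) :
  has_partial i f (h *: delta_mx 0 i + x) ->
  is_derive h 1 (line f x i) (partial i f (h *: delta_mx 0 i + x)).
Proof.
rewrite /has_partial /partial => fi.
have E : (fun k => k^-1 *: ((line f x i \o shift h) (k *: (1 : R)) - line f x i h)) =
  (fun k => k^-1 *: ((f \o shift (h *: delta_mx 0 i + x)) (k *: delta_mx 0 i) -
     f (h *: delta_mx 0 i + x))).
  apply/funext => k; rewrite /line /=; congr (_ *: (f _ - _)).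
  by rewrite /shift /= scalerDl addrA /GRing.scale/= mulr1.
split; first by rewrite /derivable E.
by rewrite /derive E.
Qed.

Lemma is_lap_laplacian (R : realType) n (f : 'rV[R]_n.+1 -> R) x :
  (forall i, (\forall y \near x, has_partial i f y) /\
    has_partial i (partial i f) x) ->
  is_lap f x (laplacian f x).
Proof.
move=> H; exists (fun i => partial i (partial i f) x) => // i.
have [Hf Hp] := H i.
exists (fun h => partial i f (h *: delta_mx 0 i + x)).
  have := near_line i Hf => {}Hf.
  near=> h; apply: is_derive_line; near: h; exact: Hf.
have := @is_derive_line R n (partial i f) x i 0.
by rewrite scale0r add0r; apply.
Unshelve. all: by end_near. Qed.

Lemma C21_is_lap (R : realType) n (D : set 'rV[R]_n.+1) T u x t :
  open D -> C21 D T u -> D x -> 0 < t < T ->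
  is_lap (u ^~ t) x (laplacian (u ^~ t) x).
Proof.
move=> oD [_ _ H1 H2] Dx tT; apply: is_lap_laplacian => i; split.
  have [+ _] := H1 i => {}H1.
  have := oD; rewrite openE => /(_ _ Dx); rewrite /interior => Dnear.
  near=> y; apply: H1; split => /=; last by rewrite in_itv.
  by near: y; exact: Dnear.
by have [+ _] := H2 i i; apply; split => //=; rewrite in_itv.
Unshelve. all: by end_near. Qed.

(** * The parabolic comparison principle *)

Lemma near_sq_lt (R : realType) n (x : 'rV[R]_n) (r : R) :
  sq x < r -> \forall y \near x, sq y < r.
Proof. by move=> xr; have := @sq_continuous R n x; move/cvgr_lt; apply. Qed.

Lemma is_derive_expl (R : realType) (c k s t : R) :
  is_derive t 1 (fun r => k * expR (c * (r - s))) (k * (c * expR (c * (t - s)))).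
Proof.
apply: der_eq (derZ k (der_exp (derZ c (derB (der_id t) (der_cst s t))))) _.
by rewrite /=; ring.
Qed.

(** Adding [k exp ((L + 1) (t - t1))] makes the inequality strict: if the sum
    touches zero for the first time, then its time derivative is nonpositive and
    its Laplacian nonnegative there, whereas the added term grows faster than
    [L * z] can compensate.  At a touching point [z] is negative, so the
    differential inequality is only asked for where [z < 0]; this is what makes
    the lemma applicable to semilinear equations. *)
Lemma comparison (R : realType) n (r t1 t2 L : R) (z : 'rV[R]_n.+1 -> R -> R) :
  0 <= L ->
  {within @cball R n.+1 r `*` `[t1, t2]%classic,
    continuous (fun p => z p.1 p.2)} ->
  (forall x, sq x <= r -> 0 <= z x t1) ->
  (forall x t, sq x = r -> t1 <= t <= t2 -> 0 <= z x t) ->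
  (forall x t, sq x < r -> t1 < t <= t2 -> z x t < 0 ->
    exists d l, [/\ is_derive t 1 (z x) d, is_lap (z ^~ t) x l &
      l + L * z x t <= d]) ->
  forall x t, sq x <= r -> t1 <= t <= t2 -> 0 <= z x t.
Proof.
move=> L0 cz z1 zb zi x0 s0 x0r /andP[s01 s02]; rewrite leNgt; apply/negP => zneg.
pose c := L + 1.
pose E := expR (c * (s0 - t1)).
have E0 : 0 < E by exact: expR_gt0.
pose k := - z x0 s0 / (2 * E).
have k0 : 0 < k by rewrite divr_gt0 ?oppr_gt0// mulr_gt0.
pose p s := k * expR (c * (s - t1)).
have p0 s : 0 < p s by rewrite mulr_gt0// expR_gt0.
have cp : continuous p.
  by move=> s; exact: der_continuous (is_derive_expl c k t1 s).
have cp2 : {within @cball R n.+1 r `*` `[t1, t2]%classic,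
    continuous (fun q => p q.2)}.
  apply: continuous_subspaceT => q; apply: (@continuous_comp _ _ _ snd p).
    exact: (@cvg_snd _ _ (nbhs q.1) (nbhs q.2)).
  exact: cp.
have [|||x [t [xr /andP[t1t tt2] zt zbefore zat]]] :=
    @first_touch R _ (@cball R n.+1 r) t1 t2 (fun x t => z x t + p t)
      (@cball_compact R n.+1 r).
- by move=> q; apply: cvgD; [exact: cz|exact: cp2].
- by move=> x xr; rewrite ltr_wpDl// z1.
- exists x0, s0; split => //; first by rewrite s01.
  have -> : p s0 = - z x0 s0 / 2.
    by rewrite /p -/E /k; field; rewrite gt_eqF.
  lra.
have zp : z x t = - p t by lra.
have tt : t1 < t <= t2 by rewrite t1t.
have xlt : sq x < r.
  rewrite lt_neqAle xr andbT; apply/eqP => xE.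
  have : 0 <= z x t by apply: zb => //; rewrite (ltW t1t).
  by rewrite zp oppr_ge0 leNgt p0.
have [|d [l [dz lz lL]]] := zi _ _ xlt tt; first by rewrite zp oppr_lt0.
have l0 : 0 <= l.
  apply: is_lap_min lz _; near=> y.
  have yr : sq y <= r by apply: ltW; near: y; exact: near_sq_lt.
  by have /= := zat y yr; lra.
have dp := is_derive_expl c k t1 t.
have := is_derive_min_left (derD dz dp) t1t; rewrite zt => H.
have {H} : d + k * (c * expR (c * (t - t1))) <= 0.
  apply: H.
  by move=> s /andP[s1 s2]; apply: ltW; apply: zbefore => //; rewrite (ltW s1).
have -> : k * (c * expR (c * (t - t1))) = c * p t by rewrite /p mulrCA.
have := p0 t; rewrite /c; nra.
Unshelve. all: by end_near. Qed.

Lemma sq_line (R : realType) n (x : 'rV[R]_n.+1) i (h : R) :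
  sq (h *: delta_mx 0 i + x) = sq x + 2 * x 0 i * h + h ^+ 2.
Proof.
rewrite /sq (bigD1 i)//= [in RHS](bigD1 i)//= !mxE !eqxx/=.
rewrite (eq_bigr (fun j => x 0 j ^+ 2)); last first.
  by move=> j ji; rewrite !mxE /= (negbTE ji) mulr0 add0r.
by rewrite /=; ring.
Qed.

(** Radial functions are written in the variable [q = |x|^2], which keeps them
    differentiable at the origin; along a line [q] is a quadratic polynomial. *)
Lemma is_lap_sq (R : realType) n (g D : R -> R) (a : R) (x : 'rV[R]_n.+1) :
  (\forall y \near sq x, is_derive (y : R) 1 g (D y)) ->
  is_derive (sq x) 1 D a ->
  is_lap (g \o @sq R n.+1) x (2 * n.+1%:R * D (sq x) + 4 * sq x * a).
Proof.
move=> gD Da; exists (fun i => 2 * D (sq x) + 4 * (x 0 i ^+ 2) * a); last first.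
  rewrite big_split/= sumr_const card_ord -mulr_suml -mulr_sumr; congr (_ + _).
    by rewrite -[RHS]mulr_natr; ring.
move=> i; pose q h : R := sq x + 2 * x 0 i * h + h ^+ 2.
have dq (h : R) : is_derive h 1 q (2 * x 0 i + 2 * h).
  apply: der_eq (derD (derD (der_cst (sq x) h) (derZ (2 * x 0 i) (der_id h)))
    (derM (der_id h) (der_id h))) _.
  by rewrite /=; ring.
have lineq : line (g \o @sq R n.+1) x i = g \o q.
  by apply/funext => h; rewrite /line /= sq_line.
have q0 : q 0 = sq x by rewrite /q mulr0 expr0n/= !addr0.
rewrite lineq; exists (fun h => (2 * x 0 i + 2 * h) * D (q h)).
  have cq : {for 0, continuous q}.
    exact: der_continuous (dq 0).
  have := cq _ ; rewrite /= q0 => /(_ _ gD) => {}gD.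
  near=> h; have gh : is_derive (q h) 1 g (D (q h)) by near: h.
  by apply: der_eq (der_comp gh (dq h)) _; rewrite mulrC.
rewrite -q0 in Da.
apply: der_eq (derM (derD (der_cst (2 * x 0 i) 0) (derZ 2 (der_id 0)))
  (der_comp Da (dq 0))) _.
by rewrite /= q0; ring.
Unshelve. all: by end_near. Qed.

Lemma is_lap_wave (R : realType) n (a : R) (x : 'rV[R]_n.+1) :
  is_lap (fun y => expR (a * y 0 0)) x (a ^+ 2 * expR (a * x 0 0)).
Proof.
exists (fun i => if i == 0 then a ^+ 2 * expR (a * x 0 0) else 0); last first.
  by rewrite (bigD1 0)//= big1 ?addr0// => i /negbTE ->.
move=> i; have [->|i0] := eqVneq i 0; last first.
  have -> : line (fun y : 'rV[R]_n.+1 => expR (a * y 0 0)) x i =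
      cst (expR (a * x 0 0)).
    by apply/funext => h; rewrite /line !mxE/= eq_sym (negbTE i0) mulr0 add0r.
  exact: is_d2_cst.
have -> : line (fun y : 'rV[R]_n.+1 => expR (a * y 0 0)) x 0 =
    (fun h => expR (a * x 0 0) * expR (a * (h - 0))).
  apply/funext => h; rewrite /line !mxE/= mulr1 subr0 mulrDr expRD; ring.
exists (fun h => (expR (a * x 0 0) * a) * expR (a * (h - 0))).
  near=> h; apply: der_eq (is_derive_expl a (expR (a * x 0 0)) 0 h) _.
  ring.
apply: der_eq (is_derive_expl a (expR (a * x 0 0) * a) 0 0) _.
rewrite subr0 mulr0 expR0; ring.
Unshelve. all: by end_near. Qed.

(** * Integrals over time intervals *)

Definition tint (R : realType) (f : R -> R) (a b : R) : R :=
  (\int[lebesgue_measure]_(s in `[a, b]) f s)%R.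

Section time_integral.
Context {R : realType}.
Notation mu := (@lebesgue_measure R).
Implicit Types (f g F : R -> R) (a b c t : R).

Definition cont_on f a b := forall s, a <= s <= b -> {for s, continuous f}.

Lemma cont_onS f a b c d : cont_on f a b -> a <= c -> d <= b -> cont_on f c d.
Proof.
by move=> cf ac db s /andP[cs sd]; apply: cf; rewrite (le_trans ac)//= (le_trans sd).
Qed.

Lemma tint_within f a b : cont_on f a b -> {within `[a, b]%classic, continuous f}.
Proof.
by move=> cf; apply: continuous_in_subspaceT => s; rewrite inE/= in_itv => /cf.
Qed.

Lemma tint_integrable f a b : cont_on f a b -> mu.-integrable `[a, b] (EFin \o f).
Proof.
move=> cf; apply: continuous_compact_integrable; first exact: segment_compact.
exact: tint_within.
Qed.

Lemma tint_derive f a b t : cont_on f a b -> a < t < b ->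
  is_derive t 1 (tint f a) (f t).
Proof.
move=> cf /andP[at_ tb].
have ct : {for t, continuous f} by apply: cf; rewrite !ltW.
have [d e] := continuous_FTC1_closed tb (tint_integrable cf) at_ ct.
split; first exact: d.
by rewrite -derive1E; exact: e.
Qed.

Lemma tint_FTC f F a b : a < b -> cont_on f a b ->
  (forall s, a <= s <= b -> is_derive s 1 F (f s)) -> tint f a b = F b - F a.
Proof.
move=> ab cf dF; rewrite /tint /Rintegral.
have cF s : a <= s <= b -> {for s, continuous F}.
  by move=> /dF; exact: der_continuous.
rewrite (@continuous_FTC2 _ f F)//.
- exact: tint_within.
- split => [s||].
  + by rewrite in_itv/= => /andP[sa sb]; have [] : is_derive s 1 F (f s)
      by apply: dF; rewrite !ltW.
  + by apply: cvg_at_right_filter; apply: cF; rewrite lexx ltW.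
  + by apply: cvg_at_left_filter; apply: cF; rewrite lexx ltW.
- move=> s; rewrite in_itv/= => /andP[sa sb].
  by rewrite derive1E; have [] : is_derive s 1 F (f s) by apply: dF; rewrite !ltW.
Qed.

Lemma tint_le f g a b : cont_on f a b -> cont_on g a b ->
  (forall s, a <= s <= b -> f s <= g s) -> tint f a b <= tint g a b.
Proof.
move=> cf cg fg; apply: le_Rintegral.
- by [].
- exact: tint_integrable.
- exact: tint_integrable.
by move=> s; rewrite /= in_itv/=; exact: fg.
Qed.

Lemma tintB f g a b : cont_on f a b -> cont_on g a b ->
  tint (fun s => f s - g s) a b = tint f a b - tint g a b.
Proof.
by move=> cf cg; apply: RintegralB;
  [by []|exact: tint_integrable|exact: tint_integrable].
Qed.

Lemma tintD f g a b : cont_on f a b -> cont_on g a b ->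
  tint (fun s => f s + g s) a b = tint f a b + tint g a b.
Proof.
by move=> cf cg; apply: RintegralD;
  [by []|exact: tint_integrable|exact: tint_integrable].
Qed.

Lemma tint_cst k a b : a <= b -> tint (cst k) a b = k * (b - a).
Proof.
move=> ab; rewrite /tint Rintegral_cst//; congr (_ * _).
rewrite [X in fine X](lebesgue_measure_itv `[a, b])/= lte_fin; case: ltP => // ba.
by rewrite (@le_anti _ _ a b) ?ab// subrr.
Qed.

Lemma tint_norm_le f k a b : a <= b -> cont_on f a b ->
  (forall s, a <= s <= b -> `|f s| <= k) -> `|tint f a b| <= k * (b - a).
Proof.
move=> ab cf fk; apply: le_trans.
  by apply: le_normr_Rintegral; [by []|exact: tint_integrable].
rewrite -tint_cst//; apply: (@tint_le (fun s => `|f s|) (cst k)) => //.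
  by move=> s sab; apply: cvg_norm; exact: cf.
by move=> s _; exact: cvg_cst.
Qed.

Lemma tint_split f a b c : cont_on f a b -> a <= c <= b ->
  tint f a b = tint f a c + tint f c b.
Proof.
move=> cf /andP[ac cb]; rewrite /tint.
have := @Rintegral_itvB R f (BLeft a) (BRight b) c (tint_integrable cf).
rewrite !bnd_simp => /(_ ac cb).
rewrite Rintegral_itv_obnd_cbnd => [H|]; first by apply/eqP; rewrite addrC -subr_eq H.
apply: integrableS (tint_integrable cf) => //.
by move=> s; rewrite /= !in_itv/= => /andP[cs ->]; rewrite (le_trans ac (ltW cs)).
Qed.

(** Compactness of [[a, b]] makes the continuity of [F x] in [x] uniform in time. *)
Lemma tint_joint_continuous (X : topologicalType) (F : X -> R -> R) a b :
  a <= b ->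
  (forall x s, a <= s <= b -> {for (x, s), continuous (fun p => F p.1 p.2)}) ->
  {within setT `*` `[a, b]%classic, continuous (fun p => tint (F p.1) a p.2)}.
Proof.
move=> ab cF.
have cF1 x : cont_on (F x) a b.
  move=> s /(cF x) c1.
  apply: (@continuous_comp _ _ _ (fun s : R => (x, s)) (fun p => F p.1 p.2) s) => //.
  exact: (cvg_pair (@cvg_cst _ x R (nbhs s) _) (@cvg_id _ (nbhs s))).
apply/subspace_continuousP => -[x0 t0] [_ /=]; rewrite in_itv/= => /andP[at0 t0b].
apply/cvgrPdist_le => e e0.
pose d := e / 2 / (b - a + 1).
have ba1 : 0 < b - a + 1 by rewrite ltr_wpDl ?subr_ge0.
have d0 : 0 < d by rewrite !divr_gt0.
have H1 : \forall x \near x0, `[a, b]%classic `<=` (fun s => `|F x0 s - F x s| <= d).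
  have := @segment_compact R a b => /compact_near_coveringP/(_ _ (nbhs x0)).
  move=> /(_ (fun x s => `|F x0 s - F x s| <= d)); apply => s.
  rewrite /= in_itv/= => /(cF x0)/cvgrPdist_le/(_ (d / 2)) /(_ (divr_gt0 d0 _)).
  move=> /(_ ltac:(done)) [[B C] /= [Bx Cs]] BC.
  exists (C, B) => //= -[s' x] [/= Cs' Bx'].
  have := BC (x, s') (conj Bx' Cs'); have := BC (x0, s') (conj (nbhs_singleton Bx) Cs').
  rewrite /= => h1 h2.
  have -> : F x0 s' - F x s' = - (F x0 s - F x0 s') + (F x0 s - F x s') by ring.
  apply: (le_trans (ler_normD _ _)); rewrite normrN.
  by move: h1 h2; lra.
have H2 : {within `[a, b]%classic, continuous (tint (F x0) a)}.
  by have := parameterized_integral_continuous ab (tint_integrable (cF1 x0)).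
move/subspace_continuousP : H2 => /(_ t0).
rewrite /= in_itv/= at0 t0b => /(_ isT)/cvgrPdist_le/(_ (e / 2)).
have e20 : 0 < e / 2 by rewrite divr_gt0.
move=> /(_ e20) H2.
exists ([set x | `[a, b]%classic `<=` (fun s => `|F x0 s - F x s| <= d)],
  [set t | `[a,b]%classic t -> `|tint (F x0) a t0 - tint (F x0) a t| <= e / 2]).
  by split.
move=> [x t] [/= Hx Ht] [_ tab]; have {Ht} := Ht tab.
move: tab; rewrite /= in_itv/= => /andP[at_ tb] Ht.
have c1 : cont_on (F x0) a t by apply: cont_onS (cF1 x0) _ _.
have c2 : cont_on (F x) a t by apply: cont_onS (cF1 x) _ _.
have : `|tint (fun s => F x0 s - F x s) a t| <= d * (t - a).
  apply: tint_norm_le => //.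
    by move=> s sa; apply: cvgB; [exact: c1|exact: c2].
  by move=> s /andP[s1 s2]; apply: Hx; rewrite /= in_itv/= s1 (le_trans s2).
rewrite tintB// => H3.
have : d * (t - a) <= e / 2.
  rewrite /d mulrAC ler_pdivrMr// ler_pM2l ?divr_gt0//; lra.
move=> H4.
have -> : tint (F x0) a t0 - tint (F x) a t = (tint (F x0) a t0 - tint (F x0) a t)
  + (tint (F x0) a t - tint (F x) a t) by ring.
apply: (le_trans (ler_normD _ _)); move: Ht H3 H4; lra.
Qed.

(** Differentiation under the integral sign; the dominating function is the
    maximum of [dF] over a compact rectangle. *)
Lemma tint_under (F dF : R -> R -> R) a b (h0 : R) : a <= b ->
  (forall h s : R, a <= s <= b -> is_derive h 1 (F ^~ s) (dF h s)) ->
  (forall h, cont_on (F h) a b) ->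
  {within setT `*` `[a, b]%classic, continuous (fun p => dF p.1 p.2)} ->
  is_derive h0 1 (fun h => tint (F h) a b) (tint (dF h0) a b).
Proof.
move=> ab dFF cF cdF.
have cA : compact (`[h0 - 1, h0 + 1]%classic `*` `[a, b]%classic).
  by apply: compact_setX; exact: segment_compact.
have cdA : {within `[h0 - 1, h0 + 1]%classic `*` `[a, b]%classic,
    continuous (fun p => `|dF p.1 p.2|)}.
  move=> p; apply: cvg_norm; move: p.
  by apply: continuous_subspaceW cdF => p [_ ?].
have [|c _ cmax] := compact_EVT_max _ cA cdA.
  by exists (h0, a); split => //=; rewrite in_itv/= ?lexx ?ab//; lra.
pose G (_ : R) : R := `|dF c.1 c.2|.
have I1 : `]h0 - 1, h0 + 1[%classic h0 by rewrite /= in_itv/=; lra.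
have mu_int h : mu.-integrable `[a, b] (EFin \o F h) by exact: tint_integrable.
have d1 h s : `[a, b]%classic s -> partial1of2 F h s = dF h s.
  by rewrite /= in_itv => /(dFF h)[_ <-]; rewrite partial1of2E.
have Gub : forall h s : R, `]h0 - 1, h0 + 1[%classic h -> `[a, b]%classic s ->
    `|partial1of2 F h s| <= G s.
  move=> h s; rewrite /= in_itv/= => hh ss; rewrite d1//.
  apply: (cmax (h, s)); rewrite inE; split => //=.
  by rewrite in_itv/=; lra.
have intG : mu.-integrable `[a, b] (EFin \o G).
  by apply: tint_integrable => s _; exact: cvg_cst.
have der : forall h s : R, `]h0 - 1, h0 + 1[%classic h -> `[a, b]%classic s ->
    derivable (F ^~ s) h 1.
  by move=> h s _; rewrite /= in_itv => /(dFF h)[].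
have mab : measurable `[a, b]%classic by [].
have int' : forall h : R, `]h0 - 1, h0 + 1[%classic h -> mu.-integrable `[a, b] (EFin \o F h).
  by move=> h _; exact: mu_int.
have G0 s : 0 <= G s by rewrite /G.
have D1 := @derivable_under_integral R _ _ mu F _ mab h0 _ _ I1 int' der G G0 intG Gub.
have D2 := @differentiation_under_integral R _ _ mu F _ mab h0 _ _ I1 int' der G G0 intG Gub.
split => //; rewrite -derive1E D2; apply: eq_Rintegral => s.
by rewrite inE; exact: d1.
Qed.

End time_integral.

(** * Time integrals of solutions *)

Lemma within_cylinder_at (R : realType) (X Y : topologicalType) (D : set X) (c d : R)
    (f : X * R -> Y) x t : open D ->
  {within D `*` [set` `]c, d[], continuous f} -> D x -> c < t < d ->
  {for (x, t), continuous f}.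
Proof.
move=> oD cf Dx tT.
have oQ : open (D `*` [set` `]c, d[]).
  apply: openI; first by apply: open_comp => // z _; exact: (@cvg_fst _ _ (nbhs z.1) (nbhs z.2)).
  apply: (@open_comp _ _ snd); last exact: itv_open.
  by move=> z _; exact: (@cvg_snd _ _ (nbhs z.1) (nbhs z.2)).
move: cf; rewrite continuous_open_subspace// => /(_ (x, t)); apply.
by rewrite inE; split => //=; rewrite in_itv.
Qed.

Lemma continuous_slice (R : realType) (X Y : topologicalType) (f : X * R -> Y) x t :
  {for (x, t), continuous f} -> {for t, continuous (fun s => f (x, s))}.
Proof.
move=> cf; apply: (@continuous_comp _ _ _ (fun s : R => (x, s)) f t) => //.
exact: (cvg_pair (@cvg_cst _ x R (nbhs t) _) (@cvg_id _ (nbhs t))).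
Qed.

Lemma tint_eq (R : realType) (f g : R -> R) a b :
  (forall s, a <= s <= b -> f s = g s) -> tint f a b = tint g a b.
Proof.
by move=> fg; apply: eq_Rintegral => s; rewrite inE/= in_itv; exact: fg.
Qed.

Lemma tint_sum (R : realType) n (F : 'I_n -> R -> R) a b : a <= b ->
  (forall i, cont_on (F i) a b) ->
  cont_on (fun s => \sum_(i < n) F i s) a b /\
  tint (fun s => \sum_(i < n) F i s) a b = \sum_(i < n) tint (F i) a b.
Proof.
move=> ab; elim: n F => [|n IH] F cF.
  have -> : (fun s => \sum_(i < 0) F i s) = cst 0.
    by apply/funext => s; rewrite big_ord0.
  by rewrite tint_cst// mul0r big_ord0; split => // s _; exact: cvg_cst.
have [c1 e1] := IH (fun i => F (lift ord0 i)) (fun i => cF (lift ord0 i)).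
have -> : (fun s => \sum_(i < n.+1) F i s) =
    (fun s => F ord0 s + \sum_(i < n) F (lift ord0 i) s).
  by apply/funext => s; rewrite big_ord_recl.
split; first by move=> s sab; apply: cvgD; [exact: cF|exact: c1].
by rewrite tintD// e1 big_ord_recl.
Qed.

Section integral_of_solution.
Context {R : realType} {n : nat} {T : R} {u : 'rV[R]_n.+1 -> R -> R}.
Context (uC : C21 setT T u)
  (ueq : forall x t, 0 < t < T ->
     derive1 (u x) t = laplacian (u ^~ t) x + expR (u x t))
  {e : R} (e0 : 0 < e).

Lemma sol_cont x t : 0 < t < T -> {for (x, t), continuous (fun z => u z.1 z.2)}.
Proof. by have [cu _ _ _] := uC; exact: (within_cylinder_at openT cu). Qed.

Lemma sol_cont_on x t : t < T -> cont_on (u x) e t.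
Proof.
move=> tT s /andP[es st]; apply: (@continuous_slice _ _ _ (fun z => u z.1 z.2) x).
by apply: sol_cont; rewrite (lt_le_trans e0)//= (le_lt_trans st).
Qed.

Lemma sol_der x t : 0 < t < T ->
  is_derive t 1 (u x) (laplacian (u ^~ t) x + expR (u x t)).
Proof.
move=> tT; have [_ [dt _] _ _] := uC.
have := dt x t; rewrite /= in_itv/= => /(_ (conj I tT)) dut.
by split => //; rewrite -derive1E ueq.
Qed.

Lemma int_sol_continuous t2 : e <= t2 -> t2 < T ->
  {within setT `*` `[e, t2]%classic, continuous (fun p => tint (u p.1) e p.2)}.
Proof.
move=> et t2T; apply: tint_joint_continuous => // x s /andP[es st].
by apply: sol_cont; rewrite (lt_le_trans e0)//= (le_lt_trans st).
Qed.

Lemma int_sol_derive x t : e < t < T -> is_derive t 1 (tint (u x) e) (u x t).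
Proof.
move=> /andP[et tT]; apply: (@tint_derive _ _ _ ((t + T) / 2)); last by lra.
by apply: sol_cont_on; lra.
Qed.

(** The equation turns the time integral of the Laplacian into the integral of
    [u_t - exp u], whose first term integrates to a difference of values of [u].
    The lower limit [e] is positive because the derivatives of [u] are not
    controlled near time zero. *)
Lemma int_sol_lap x t : e < t < T ->
  is_lap (fun y => tint (u y) e t) x
    (u x t - u x e - tint (fun s => expR (u x s)) e t).
Proof.
move=> /andP[et tT]; have [_ [_ cdu] d1 d2] := uC.
have sT s : e <= s <= t -> 0 < s < T.
  by move=> /andP[es st]; rewrite (lt_le_trans e0)//= (le_lt_trans st).
have c1 i y s : e <= s <= t ->
    {for (y, s), continuous (fun z => partial i (u ^~ z.2) z.1)}.
  by move=> /sT sT'; have [_ c] := d1 i; exact: (within_cylinder_at openT c).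
have c2 i y s : e <= s <= t ->
    {for (y, s), continuous (fun z => partial i (partial i (u ^~ z.2)) z.1)}.
  by move=> /sT sT'; have [_ c] := d2 i i; exact: (within_cylinder_at openT c).
have comp i (f : 'rV[R]_n.+1 -> R -> R) :
    (forall y s, e <= s <= t -> {for (y, s), continuous (fun z => f z.1 z.2)}) ->
    {within setT `*` `[e, t]%classic,
      continuous (fun p : R * R => f (p.1 *: delta_mx 0 i + x) p.2)}.
  move=> cf; apply: continuous_in_subspaceT => -[h s]; rewrite inE /= in_itv/= => -[_ st].
  apply: (@continuous_comp _ _ _ (fun p : R * R => (p.1 *: delta_mx 0 i + x, p.2))
    (fun z => f z.1 z.2)); last exact: cf.
  apply: (@cvg_pair _ _ _ _ (nbhs (h *: delta_mx 0 i + x)) (nbhs s)) => /=.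
    apply: (@cvg_comp _ _ _ fst (fun k : R => k *: delta_mx 0 i + x) (nbhs (h, s))
      (nbhs h) (nbhs (h *: delta_mx 0 i + x))); last exact: line_continuous.
    exact: (@cvg_fst _ _ (nbhs h) (nbhs s)).
  exact: (@cvg_snd _ _ (nbhs h) (nbhs s)).
have slice y (f : 'rV[R]_n.+1 -> R -> R) :
    (forall y s, e <= s <= t -> {for (y, s), continuous (fun z => f z.1 z.2)}) ->
    cont_on (f y) e t.
  by move=> cf s /(cf y)/continuous_slice.
pose a i := tint (fun s => partial i (partial i (u ^~ s)) x) e t.
have ce : cont_on (fun s => expR (u x s)) e t.
  move=> s st; apply: (@continuous_comp _ _ _ (u x) expR); last exact: continuous_expR.
  exact: sol_cont_on tT s st.
have cd : cont_on (fun s => derive1 (u x) s) e t.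
  move=> s st; have := within_cylinder_at openT cdu I (sT s st).
  by move=> /(_ x)/continuous_slice.
have -> : u x t - u x e - tint (fun s => expR (u x s)) e t = \sum_(i < n.+1) a i.
  have [c3 <-] := tint_sum (ltW et) (fun i => slice x
    (fun y s => partial i (partial i (u ^~ s)) y) (c2 i)).
  have dF s : e <= s <= t -> is_derive s 1 (u x) (derive1 (u x) s).
    by move=> /sT sT'; rewrite ueq//; exact: sol_der.
  rewrite -(tint_FTC et cd dF) -tintB//.
  by apply: tint_eq => s st; rewrite ueq ?sT// addrK.
exists a => // i.
exists (fun h => tint (fun s => partial i (u ^~ s) (h *: delta_mx 0 i + x)) e t).
  near=> h; apply: (@tint_under _ (fun h s => u (h *: delta_mx 0 i + x) s)
    (fun h s => partial i (u ^~ s) (h *: delta_mx 0 i + x))).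
  - exact: ltW.
  - move=> k s st; apply: is_derive_line.
    by have [+ _] := d1 i; apply; split => //=; rewrite in_itv/= sT.
  - by move=> k; exact: sol_cont_on.
  - exact: (comp i (fun y s => partial i (u ^~ s) y) (c1 i)).
have -> : a i = tint (fun s => partial i (partial i (u ^~ s)) (0 *: delta_mx 0 i + x)) e t.
  by rewrite scale0r add0r.
apply: (@tint_under _ (fun h s => partial i (u ^~ s) (h *: delta_mx 0 i + x))
    (fun h s => partial i (partial i (u ^~ s)) (h *: delta_mx 0 i + x))).
- exact: ltW.
- move=> h s st; apply: is_derive_line.
  by have [+ _] := d2 i i; apply; split => //=; rewrite in_itv/= sT.
- by move=> h; exact: (slice _ (fun y s => partial i (u ^~ s) y) (c1 i)).
- exact: (comp i (fun y s => partial i (partial i (u ^~ s)) y) (c2 i)).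
Unshelve. all: by end_near. Qed.

End integral_of_solution.

(** * Two barriers for the heat equation *)

Lemma continuous_space (R : realType) (X : topologicalType) (f : X -> R) :
  continuous f -> continuous (fun p : X * R => f p.1).
Proof.
move=> cf [x t]; apply: (@cvg_comp _ _ _ fst f (nbhs (x, t)) (nbhs x) (nbhs (f x))).
  exact: (@cvg_fst _ _ (nbhs x) (nbhs t)).
exact: cf.
Qed.

Lemma continuous_time (R : realType) (X : topologicalType) (f : R -> R) :
  continuous f -> continuous (fun p : X * R => f p.2).
Proof.
move=> cf [x t]; apply: (@cvg_comp _ _ _ snd f (nbhs (x, t)) (nbhs t) (nbhs (f t))).
  exact: (@cvg_snd _ _ (nbhs x) (nbhs t)).
exact: cf.
Qed.

(** The barrier is a multiple of [exp (a x_0 + a^2 t)], a solution of the heat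
    equation, minus the constant that makes it nonpositive on the ball at time
    [s0].  For [a] of order [r / (s1 - s0)] its value at the centre is a Gaussian
    in [r]: a lower bound for the probability that a Brownian motion starting
    there leaves the ball within the time [s1 - s0]. *)
Lemma exit_barrier (R : realType) n (r H a s0 s1 : R) (z : 'rV[R]_n.+1 -> R -> R) :
  0 <= r -> 0 <= H -> 0 <= a -> s0 <= s1 ->
  {within @cball R n.+1 (r ^+ 2) `*` `[s0, s1]%classic,
    continuous (fun p => z p.1 p.2)} ->
  (forall x, sq x <= r ^+ 2 -> 0 <= z x s0) ->
  (forall x t, sq x = r ^+ 2 -> s0 <= t <= s1 -> H <= z x t) ->
  (forall x t, sq x < r ^+ 2 -> s0 < t <= s1 ->
    exists d l, [/\ is_derive t 1 (z x) d, is_lap (z ^~ t) x l & l <= d]) ->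
  H * (expR (- (a * r)) - expR (- (a ^+ 2 * (s1 - s0)))) <= z 0 s1.
Proof.
move=> r0 H0 a0 s01 cz z0 zb zi.
pose K := H * expR (- (a * r) - a ^+ 2 * (s1 - s0)).
have K0 : 0 <= K by rewrite mulr_ge0// expR_ge0.
pose E s := K * expR (a ^+ 2 * (s - s0)).
have E0 s : 0 <= E s by rewrite mulr_ge0// expR_ge0.
pose W (x : 'rV[R]_n.+1) := expR (a * x 0 0).
have cE : continuous (fun p : 'rV[R]_n.+1 * R => E p.2).
  by apply: continuous_time => s; exact: der_continuous (is_derive_expl (a ^+ 2) K s0 s).
have cW : continuous (fun p : 'rV[R]_n.+1 * R => W p.1).
  apply: continuous_space => x.
  apply: (@cvg_comp _ _ _ (fun x : 'rV[R]_n.+1 => a * x 0 0) expR _ (nbhs (a * x 0 0))).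
    exact: (cvgM (@cvg_cst _ a _ (nbhs x) _) (@coord_continuous R 1 n.+1 0 0 x)).
  exact: continuous_expR.
have cb : {within @cball R n.+1 (r ^+ 2) `*` `[s0, s1]%classic,
    continuous (fun p => E p.2 * W p.1 - K * expR (a * r))}.
  apply: continuous_subspaceT => p; apply: cvgB; last exact: cvg_cst.
  by apply: cvgM; [exact: cE|exact: cW].
have cz' : {within @cball R n.+1 (r ^+ 2) `*` `[s0, s1]%classic,
    continuous (fun p => z p.1 p.2 - (E p.2 * W p.1 - K * expR (a * r)))}.
  by move=> p; apply: cvgB; [exact: cz|exact: cb].
have KE : K * expR (a * r) = H * expR (- (a ^+ 2 * (s1 - s0))).
  by rewrite /K -mulrA -expRD; congr (_ * expR _); ring.
have Wle x : sq x <= r ^+ 2 -> W x <= expR (a * r).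
  move=> xr; rewrite ler_expR ler_wpM2l//.
  have := coord_le_sq x 0 => /le_trans/(_ xr) h.
  by apply: le_trans (ler_norm _) _; rewrite -ler_sqr ?nnegrE// real_normK// num_real.
have := @comparison R n (r ^+ 2) s0 s1 0
  (fun x t => z x t - (E t * W x - K * expR (a * r))) (lexx _) cz' _ _ _ 0 s1.
rewrite s01 lexx subr_ge0; have -> : sq (0 : 'rV[R]_n.+1) = 0.
  by rewrite /sq big1// => i _; rewrite mxE expr0n.
rewrite sqr_ge0 => P; apply: le_trans (P _ _ _ isT isT).
- rewrite KE /W mxE mulr0 expR0 mulr1 /E /K -mulrA -expRD mulrBr.
  by rewrite subrK.
- move=> x xr; rewrite subr_ge0; apply: le_trans (z0 x xr).
  rewrite /E subrr mulr0 expR0 mulr1 -mulrBr mulr_ge0_le0// subr_le0.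
  exact: Wle.
- move=> x t xr st; rewrite subr_ge0; apply: le_trans (zb x t xr st).
  rewrite lerBlDr; apply: (@le_trans _ _ H); last first.
    by rewrite lerDl mulr_ge0// expR_ge0.
  apply: (@le_trans _ _ (E t * expR (a * r))).
    by rewrite ler_wpM2l// Wle// xr.
  rewrite /E /K -!mulrA -!expRD ler_piMr// -expR0 ler_expR.
  case/andP: st => st1 st2.
  have : 0 <= a ^+ 2 * (s1 - t) by rewrite mulr_ge0 ?sqr_ge0 ?subr_ge0.
  lra.
- move=> x t xr st _; have [d [l [dz lz ld]]] := zi x t xr st.
  exists (d - (a ^+ 2 * E t * W x - 0)), (l - (E t * (a ^+ 2 * W x) - 0)); split.
  + have dE : is_derive t 1 (fun t => E t * W x) (a ^+ 2 * E t * W x).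
      apply: der_eq (derM (is_derive_expl (a ^+ 2) K s0 t) (der_cst (W x) t)) _.
      by rewrite /E; ring.
    exact: (derB dz (derB dE (der_cst _ t))).
  + exact: (is_lapB lz (is_lapB (is_lapZ (E t) (is_lap_wave a x)) (is_lap_cst _ x))).
  + by rewrite mul0r addr0; lra.
Qed.

(** A quantitative Phragmen-Lindelof principle.  The function
    [exp (al t * |x|^2 + be t)] is a supersolution of the heat equation as soon
    as [al' >= 4 al^2] and [be'] is at least [2 al] times the dimension.  With
    [al] growing linearly from [A], this holds until [al] reaches [2 A], that is
    for a time [1 / (16 A)]. *)
Lemma gauss_comparison (R : realType) n (r A t1 t2 k : R) (z : 'rV[R]_n.+1 -> R -> R) :
  0 <= r -> 0 < A -> 0 <= k -> 16 * A * (t2 - t1) <= 1 ->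
  {within @cball R n.+1 r `*` `[t1, t2]%classic,
    continuous (fun p => z p.1 p.2)} ->
  (forall x, sq x <= r -> z x t1 <= 0) ->
  (forall x t, sq x = r -> t1 <= t <= t2 -> z x t <= k * expR (A * r)) ->
  (forall x t, sq x < r -> t1 < t <= t2 ->
    exists d l, [/\ is_derive t 1 (z x) d, is_lap (z ^~ t) x l & d <= l]) ->
  forall x t, sq x <= r -> t1 <= t <= t2 ->
  z x t <= k * expR (2 * A * sq x + 4 * n.+1%:R * A * (t2 - t1)).
Proof.
move=> r0 A0 k0 At cz z0 zb zi.
have m0 : 0 < n.+1%:R :> R by rewrite ltr0n.
set m := n.+1%:R in m0 *.
pose al t := A + 16 * A ^+ 2 * (t - t1).
pose be t := 4 * m * A * (t - t1).
pose Y (x : 'rV[R]_n.+1) t := k * expR (al t * sq x + be t).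
have dal (t : R) : is_derive t 1 al (16 * A ^+ 2).
  apply: der_eq (derD (der_cst A t) (derZ (16 * A ^+ 2)
    (derB (der_id t) (der_cst t1 t)))) _; ring.
have dbe (t : R) : is_derive t 1 be (4 * m * A).
  apply: der_eq (derZ (4 * m * A) (derB (der_id t) (der_cst t1 t))) _; ring.
have cY : continuous (fun p : 'rV[R]_n.+1 * R => Y p.1 p.2).
  move=> p; apply: cvgM; first exact: cvg_cst.
  apply: (@cvg_comp _ _ _ (fun p : 'rV[R]_n.+1 * R => al p.2 * sq p.1 + be p.2) expR _
    (nbhs (al p.2 * sq p.1 + be p.2))); last exact: continuous_expR.
  apply: cvgD; [apply: cvgM|].
  - by apply: (@continuous_time R _ al) => t; exact: der_continuous (dal t).
  - by apply: (@continuous_space R _ (@sq R n.+1)); exact: sq_continuous.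
  - by apply: (@continuous_time R _ be) => t; exact: der_continuous (dbe t).
have czY : {within @cball R n.+1 r `*` `[t1, t2]%classic,
    continuous (fun p => Y p.1 p.2 - z p.1 p.2)}.
  have cY' : {within @cball R n.+1 r `*` `[t1, t2]%classic,
    continuous (fun p => Y p.1 p.2)} by apply: continuous_subspaceT => p; exact: cY.
  by move=> p; apply: cvgB; [exact: cY'|exact: cz].
have Y0 x t : 0 <= Y x t by rewrite mulr_ge0// expR_ge0.
move=> x t xr tt.
have : 0 <= Y x t - z x t.
  apply: (@comparison R n r t1 t2 0 (fun x t => Y x t - z x t)) => //.
  - by move=> y yr; rewrite subr_ge0; apply: le_trans (z0 y yr) _.
  - move=> y s yr ss; rewrite subr_ge0; apply: le_trans (zb y s yr ss) _.
    rewrite ler_wpM2l// ler_expR yr /al /be.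
    case/andP: ss => s1 s2.
    have h1 : 0 <= A ^+ 2 * (s - t1) * r.
      by apply: mulr_ge0 (mulr_ge0 (sqr_ge0 A) _) r0; rewrite subr_ge0.
    have h2 : 0 <= m * A * (s - t1).
      by apply: mulr_ge0 (mulr_ge0 (ltW m0) (ltW A0)) _; rewrite subr_ge0.
    lra.
  - move=> y s yr ss _; have [d [l [dz lz ld]]] := zi y s yr ss.
    exists (k * (expR (al s * sq y + be s) * (al s * 0 + sq y * (16 * A ^+ 2) + 4 * m * A)) - d),
      (k * (2 * m * (expR (al s * sq y + be s) * al s) +
        4 * sq y * ((expR (al s * sq y + be s) * al s) * al s)) - l); split.
    + exact: (derB (derZ k (der_exp (derD (derM (dal s) (der_cst (sq y) s)) (dbe s)))) dz).
    + apply: (fun H => is_lapB (is_lapZ k H) lz).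
      have dg (w : R) : is_derive w 1 (fun q => expR (al s * q + be s))
          (expR (al s * w + be s) * al s).
        apply: der_eq (der_exp (derD (derZ (al s) (der_id w)) (der_cst (be s) w))) _.
        by rewrite /=; ring.
      apply: (@is_lap_sq R n (fun q => expR (al s * q + be s))
        (fun q => expR (al s * q + be s) * al s)).
        by near=> w; exact: dg.
      apply: der_eq (derM (dg (sq y)) (der_cst (al s) (sq y))) _.
      by rewrite /=; ring.
    + rewrite mul0r addr0.
      have e0 := expR_ge0 (al s * sq y + be s).
      set e := expR _ in e0 *.
      case/andP: ss => s1 s2.
      have al1 : A <= al s.
        rewrite /al lerDl; apply: mulr_ge0; last by rewrite subr_ge0 ltW.
        by apply: mulr_ge0 => //; exact: sqr_ge0.
      have al2 : al s <= 2 * A.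
        have : A * (16 * A * (s - t1)) <= A * 1.
          rewrite ler_pM2l//; apply: le_trans At; apply: ler_wpM2l; [lra|lra].
        rewrite /al; lra.
      have h1 : m * al s <= m * (2 * A) by rewrite ler_pM2l.
      have h2 : sq y * (al s * al s) <= sq y * (4 * A ^+ 2).
        by apply: ler_wpM2l; [exact: sq_ge0|nra].
      have h3 : k * e * (2 * m * al s + 4 * sq y * (al s * al s)) <=
         k * e * (sq y * (16 * A ^+ 2) + 4 * m * A).
        by apply: ler_wpM2l; [exact: mulr_ge0|lra].
      lra.
rewrite subr_ge0 => /le_trans; apply.
rewrite ler_wpM2l// ler_expR.
case/andP: tt => s1 s2.
have h1 : be t <= 4 * m * A * (t2 - t1).
  rewrite /be; apply: ler_wpM2l; last by lra.
  by apply: mulr_ge0 (mulr_ge0 _ (ltW m0)) (ltW A0).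
have h2 : al t * sq x <= 2 * A * sq x.
  apply: ler_wpM2r; first exact: sq_ge0.
  have : A * (16 * A * (t - t1)) <= A * 1.
    rewrite ler_pM2l//; apply: le_trans At; apply: ler_wpM2l; [lra|lra].
  rewrite /al; lra.
lra.
Unshelve. all: by end_near. Qed.

(** * The integrated deficit of a solution on the whole space *)

Lemma sq0 (R : realType) n : sq (0 : 'rV[R]_n) = 0.
Proof. by rewrite /sq big1// => i _; rewrite mxE expr0n. Qed.

Lemma tint_point (R : realType) (f : R -> R) a : tint f a a = 0.
Proof. by rewrite /tint set_itv1 Rintegral_set1. Qed.

Section whole_space.
Context {R : realType} {n : nat}.
Implicit Types (T K a b e c s t : R) (x y : 'rV[R]_n.+1) (u : 'rV[R]_n.+1 -> R -> R).

Definition entire_solution T u : Prop :=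
  [/\ C21 setT T u,
    forall x t, 0 < t < T ->
      derive1 (u x) t = laplacian (u ^~ t) x + expR (u x t) &
    forall t, 0 < t < T -> forall x y, sq x = sq y -> u x t = u y t].

Definition bounded_window T u K a b : Prop :=
  [/\ 0 <= K, 0 <= a < b, b < T,
    forall x t, 0 < t <= b -> u x t <= K &
    forall t, 0 < t <= b -> - K <= u 0 t].

Lemma int_sol_at T u e x t : entire_solution T u -> 0 < e -> e < t < T ->
  {for (x, t), continuous (fun p => tint (u p.1) e p.2)}.
Proof.
move=> [uC ueq _] e0 /andP[et tT].
have /= := int_sol_continuous uC e0 (t2 := (t + T) / 2) ltac:(lra) ltac:(lra).
move=> c; have {}c : {within setT `*` `]e, ((t + T) / 2)[%classic,
    continuous (fun p => tint (u p.1) e p.2)}.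
  apply: continuous_subspaceW c => -[y s] [_ /=].
  by rewrite !in_itv/= => /andP[/ltW -> /ltW ->].
apply: (within_cylinder_at openT c) => //; lra.
Qed.

(** The time integral of [K - u] from [e] to [t].  Where [u <= K] it is
    nondecreasing in [t], so that a large value on a circle at one time is a
    large boundary value for all later times; [K - u] itself has no such
    persistence. *)
Definition gap u K e x t : R := K * (t - e) - tint (u x) e t.

Lemma gap_split T u K a b e c x t :
  entire_solution T u -> bounded_window T u K a b -> a < e -> e <= c <= t -> t <= b ->
  gap u K e x t = gap u K e x c + gap u K c x t.
Proof.
move=> hu hK; have [uC ueq u_rad] := hu.
have [K0 /andP[a0 ab] bT uK uK0] := hK.
move=> ae ect tb; rewrite /gap (@tint_split _ _ e t c)//; first by ring.
by apply: (sol_cont_on uC (e := e)); lra.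
Qed.

Lemma gap_ge0 T u K a b e x t :
  entire_solution T u -> bounded_window T u K a b ->
  a < e -> e <= t -> t <= b -> 0 <= gap u K e x t.
Proof.
move=> hu hK; have [uC ueq u_rad] := hu.
have [K0 /andP[a0 ab] bT uK uK0] := hK.
move=> ae et tb; rewrite /gap -tint_cst// subr_ge0; apply: tint_le.
- by apply: (sol_cont_on uC (e := e)); lra.
- by move=> s _; exact: cvg_cst.
- by move=> s st; apply: uK; lra.
Qed.

Lemma gap_derive T u K a b e x t :
  entire_solution T u -> bounded_window T u K a b -> a < e -> e < t <= b ->
  is_derive t 1 (gap u K e x) (K - u x t).
Proof.
move=> hu hK; have [uC ueq u_rad] := hu.
have [K0 /andP[a0 ab] bT uK uK0] := hK.
move=> ae /andP[et tb].
have di : is_derive t 1 (tint (u x) e) (u x t).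
  by apply: (int_sol_derive uC); lra.
apply: der_eq (derB (derZ K (derB (der_id t) (der_cst e t))) di) _.
by ring.
Qed.

Lemma gap_lap T u K a b e x t :
  entire_solution T u -> bounded_window T u K a b -> a < e -> e < t <= b ->
  is_lap (fun y => gap u K e y t) x
    (u x e - u x t + tint (fun s => expR (u x s)) e t).
Proof.
move=> hu hK; have [uC ueq u_rad] := hu.
have [K0 /andP[a0 ab] bT uK uK0] := hK.
move=> ae /andP[et tb].
have h := int_sol_lap uC ueq (e := e) ltac:(lra) x (t := t) ltac:(lra).
have := is_lapB (is_lap_cst (K * (t - e)) x) h.
by congr is_lap; ring.
Qed.

Lemma gap_exp T u K a b e x s t :
  entire_solution T u -> bounded_window T u K a b -> a < e -> e <= s -> s <= t -> t <= b ->
  cont_on (fun s => expR (u x s)) e t /\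
  tint (fun s => expR (u x s)) e s <= tint (fun s => expR (u x s)) e t.
Proof.
move=> hu hK; have [uC ueq u_rad] := hu.
have [K0 /andP[a0 ab] bT uK uK0] := hK.
move=> ae es st tb.
have c : cont_on (fun s => expR (u x s)) e t.
  move=> r rt; apply: (@continuous_comp _ _ _ (u x) expR); last exact: continuous_expR.
  by apply: (sol_cont_on uC (e := e) _ _ rt); lra.
split => //; rewrite (tint_split c (c := s)) ?es// lerDl.
rewrite -(mul0r (t - s)) -tint_cst//; apply: tint_le.
- by move=> r _; exact: cvg_cst.
- by apply: cont_onS c _ _.
- by move=> r _; exact: expR_ge0.
Qed.

Lemma gap_exp_bounds T u K a b e x t :
  entire_solution T u -> bounded_window T u K a b -> a < e -> e <= t -> t <= b ->
  0 <= tint (fun s => expR (u x s)) e t <= expR K * (t - e).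
Proof.
move=> hu hK; have [uC ueq u_rad] := hu.
have [K0 /andP[a0 ab] bT uK uK0] := hK.
move=> ae et tb; have [c h] := @gap_exp _ _ _ _ _ e x e t hu hK ae (lexx _) et tb.
move: h; rewrite tint_point => -> /=; rewrite -tint_cst//; apply: tint_le => //.
- by move=> r _; exact: cvg_cst.
- by move=> s st; rewrite ler_expR; apply: uK; lra.
Qed.

Lemma gap_within T u K a b (A : set 'rV[R]_n.+1) e t :
  entire_solution T u -> bounded_window T u K a b ->
  a < e -> e <= t -> t <= b ->
  {within A `*` `[e, t]%classic, continuous (fun p => gap u K e p.1 p.2)}.
Proof.
move=> hu hK; have [uC ueq u_rad] := hu.
have [K0 /andP[a0 ab] bT uK uK0] := hK.
move=> ae et tb.
have c1 : {within A `*` `[e, t]%classic, continuous (fun p => tint (u p.1) e p.2)}.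
  have /= := int_sol_continuous uC (e := e) ltac:(lra) (t2 := t) et ltac:(lra).
  by apply: continuous_subspaceW => -[y s] [_ /=].
have c2 : {within A `*` `[e, t]%classic,
    continuous (fun p : 'rV[R]_n.+1 * R => K * (p.2 - e))}.
  apply: continuous_subspaceT => p; apply: (@continuous_time R _ (fun s => K * (s - e))) => s.
  exact: der_continuous (derZ K (derB (der_id s) (der_cst e s))).
by move=> p; apply: cvgB; [exact: c2|exact: c1].
Qed.

Definition growth_const K a b : R :=
  let d := (b - a) / 2 in 2 * (2 * K * d * 2 + expR K * b * d).

(** A value of the gap on the circle through [x] persists for the time [d], so by
    [exit_barrier] a Gaussian fraction of it is seen at the origin, where the gap
    is bounded because [u 0] is.  The bound does not depend on the starting time
    [e]. *)
Lemma gap_growth T u K a b e x s :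
  entire_solution T u -> bounded_window T u K a b -> let d := (b - a) / 2 in
  a < e -> e < s -> s <= a + d -> d <= sq x ->
  gap u K e x s <= growth_const K a b * expR (2 * sq x / d).
Proof.
move=> hu hK; have [uC ueq u_rad] := hu.
have [K0 /andP[a0 ab] bT uK uK0] := hK.
move=> d ae es sd dx; rewrite /growth_const -/d; set B := 2 * _.
have d0 : 0 < d by rewrite /d; lra.
pose r := Num.sqrt (sq x); have r2 : r ^+ 2 = sq x by rewrite sqr_sqrtr ?sq_ge0.
have r0 : 0 <= r by exact: sqrtr_ge0.
(* With this slope the two exponents of the barrier are -q and -2 q. *)
pose al := 2 * r / d.
have H0 : 0 <= gap u K e x s by apply: (gap_ge0 _ hu hK) => //; rewrite /d in sd; lra.
have eK := expR_gt0 K.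
have sdb : s + d <= b by rewrite /d in sd *; lra.
pose z y t := gap u K e y t + expR K * b * (t - s).
have := @exit_barrier R n r (gap u K e x s) al s (s + d) z r0 H0 _ _ _ _ _ _.
have -> : al * r = 2 * sq x / d by rewrite /al -r2; field; rewrite gt_eqF.
have -> : al ^+ 2 * (s + d - s) = 2 * (2 * sq x / d).
  by rewrite /al -r2; field; rewrite gt_eqF.
set q := 2 * sq x / d => bar.
(* r^2 >= d makes the second exponential at most half of the first. *)
have q2 : 2 <= q by rewrite /q ler_pdivlMr//; lra.
have {bar} : gap u K e x s * (expR (- q) - expR (- (2 * q))) <= z 0 (s + d).
  apply: bar.
  - by rewrite /al !mulr_ge0 ?invr_ge0// ltW.
  - lra.
  - have c1 : {within @cball R n.+1 (r ^+ 2) `*` `[s, s + d]%classic,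
        continuous (fun p => gap u K e p.1 p.2)}.
      have := @gap_within _ _ _ _ _ (@cball R n.+1 (r ^+ 2)) e (s + d) hu hK ae.
      move=> /(_ ltac:(lra) sdb); apply: continuous_subspaceW => -[y t] [yr /=].
      by rewrite !in_itv/= => /andP[st ->]; split => //=; rewrite (le_trans (ltW es) st).
    have c2 : {within @cball R n.+1 (r ^+ 2) `*` `[s, s + d]%classic,
        continuous (fun p : 'rV[R]_n.+1 * R => expR K * b * (p.2 - s))}.
      apply: continuous_subspaceT => p.
      apply: (@continuous_time R _ (fun t => expR K * b * (t - s))) => t.
      exact: der_continuous (derZ _ (derB (der_id t) (der_cst s t))).
    by move=> p; apply: cvgD; [exact: c1|exact: c2].
  - move=> y _; rewrite /z subrr mulr0 addr0; apply: (gap_ge0 _ hu hK) => //; lra.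
  - move=> y t; rewrite r2 => yx /andP[st tsd].
    have -> : gap u K e x s = gap u K e y s.
      rewrite /gap; congr (_ - _); apply: tint_eq => c cs; apply: u_rad => //.
      by rewrite /d in sd; lra.
    rewrite /z (@gap_split _ _ _ _ _ e s y t hu hK)//; [|lra|lra].
    have := @gap_ge0 _ _ _ _ _ s y t hu hK ltac:(lra) st ltac:(lra).
    have : 0 <= expR K * b * (t - s) by rewrite !mulr_ge0 ?(ltW eK)//; lra.
    lra.
  - move=> y t yr /andP[st tsd].
    exists ((K - u y t) + expR K * b * (1 - 0)),
      ((u y e - u y t + tint (fun s => expR (u y s)) e t) + 0); split.
    + have gd : is_derive t 1 (gap u K e y) (K - u y t).
        by apply: (gap_derive _ hu hK) => //; lra.
      exact: (derD gd (derZ (expR K * b) (derB (der_id t) (der_cst s t)))).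
    + apply: (is_lapD (gap_lap y hu hK ae _)); [lra|exact: is_lap_cst].
    + have := @gap_exp_bounds _ _ _ _ _ e y t hu hK ae ltac:(lra) ltac:(lra).
      have : u y e <= K by apply: uK; lra.
      have : expR K * (t - e) <= expR K * b by rewrite ler_pM2l//; lra.
      lra.
have zb : z 0 (s + d) <= B / 2.
  have : - K * (s + d - e) <= tint (u 0) e (s + d).
    rewrite -tint_cst; [|lra]; apply: tint_le.
    - by move=> ? _; exact: cvg_cst.
    - by apply: (sol_cont_on uC (e := e)); lra.
    - by move=> c cs; apply: uK0; lra.
  have : K * (s + d - e) <= K * (2 * d) by rewrite ler_wpM2l//; lra.
  rewrite /z /gap /B; lra.
move=> h1.
have E : expR (- (2 * q)) <= expR (- q) / 2.
  have -> : - (2 * q) = - q + - q by ring.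
  rewrite expRD ler_pM2l ?expR_gt0// expRN lef_pV2 ?posrE ?expR_gt0//.
  by have := expR_ge1Dx q; lra.
have h2 : gap u K e x s * (expR (- q) / 2) <= B / 2.
  apply: le_trans (le_trans h1 zb); apply: ler_wpM2l => //; lra.
rewrite -ler_pdivrMr ?expR_gt0// -expRN; lra.
Qed.
End whole_space.

(** * Nonnegativity on the whole space *)

Section whole_space_nonneg.
Context {R : realType} {n : nat}.
Implicit Types (T K a b e c s t h : R) (x y : 'rV[R]_n.+1) (u : 'rV[R]_n.+1 -> R -> R).

(** Compactness of the ball makes the continuity of [u] at time [a] uniform in
    space. *)
Lemma near_initial_ge T u a (r th : R) :
  {within setT `*` [set` `[0, T[], continuous (fun z => u z.1 z.2)} ->
  0 <= a < T -> (forall x, 0 <= u x a) -> 0 < th ->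
  \forall e \near a^'+, @cball R n.+1 r `<=` (fun y => - th <= u y e).
Proof.
move=> cu /andP[a0 aT] ua th0.
have := @cball_compact R n.+1 r => /compact_near_coveringP/(_ _ a^'+).
move=> /(_ (fun e y => - th <= u y e)); apply => y _.
have Qya : (setT `*` [set` `[0, T[]) (y, a) by split => //=; rewrite in_itv/= a0.
move/subspace_continuousP : cu => /(_ _ Qya) /cvgr_ge /(_ (- th)).
have lt : - th < u y a by rewrite (lt_le_trans _ (ua y))// oppr_lt0.
move=> /(_ lt) [[B C] /= [By Ca] BC].
exists (B, [set e | C e /\ a < e < T]) => /=.
  split => //; have Ca' : \forall e \near a^'+, C e by exact: (@cvg_within _ (nbhs a)).
  near=> e; split; first by near: e.
  by apply/andP; split; near: e; [exact: nbhs_right_gt|exact: nbhs_right_lt].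
move=> [y' e] /= [By' [Ce /andP[ae eT]]]; apply: (BC (y', e)) => //.
by split => //=; rewrite in_itv/= eT (le_trans a0 (ltW ae)).
Unshelve. all: by end_near. Qed.

Lemma growth_const_ge0 K a b : 0 <= K -> 0 <= a < b -> 0 <= growth_const K a b.
Proof.
move=> K0 /andP[a0 ab]; rewrite /growth_const.
have d0 : 0 <= (b - a) / 2 by lra.
have b0 : 0 <= b by lra.
have h1 : 0 <= K * ((b - a) / 2) by exact: mulr_ge0.
have h2 : 0 <= expR K * b * ((b - a) / 2) by apply: mulr_ge0 (mulr_ge0 (expR_ge0 K) b0) d0.
lra.
Qed.

Lemma exp_dominates (B k d : R) : 0 < k -> 0 < d -> 0 <= B -> forall r,
  d * (B / k) <= r -> B <= k * expR (r / d).
Proof.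
move=> k0 d0 B0 r dr.
have h : B / k <= r / d by rewrite ler_pdivlMr// mulrC.
have := expR_ge1Dx (r / d); have := divr_ge0 B0 (ltW k0) => h1 h2.
rewrite -ler_pdivrMl// mulrC; lra.
Qed.

(** If [K - u] is at most [K] at time [a], then its time integrals from [a] on are
    at most [K] times the elapsed time.  The gap started at [e > a] is compared on
    a large ball of squared radius [r] with a linear function of time; [e] is
    taken so close to [a] that [u] is almost nonnegative on that ball at time
    [e]. *)
Lemma gap_le_elapsed T u K a b x t1 t :
  entire_solution T u -> bounded_window T u K a b ->
  {within setT `*` [set` `[0, T[], continuous (fun z => u z.1 z.2)} ->
  (forall y, 0 <= u y a) ->
  let d := (b - a) / 2 in
  a < t1 -> t1 <= t -> t <= a + d / 48 ->
  gap u K t1 x t <= K * (t - a).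
Proof.
move=> hu hK cu ua d at1 t1t td.
have [uC ueq u_rad] := hu; have [K0 /andP[a0 ab] bT uK uK0] := hK.
have d0 : 0 < d by rewrite /d; lra.
have tb : t <= b by rewrite /d in td; lra.
apply/ler_addgt0Pr => ep ep0.
(* The time d / 48 is the time 1 / (16 A) of gauss_comparison. *)
pose A := 3 / d; have A0 : 0 < A by rewrite divr_gt0.
have Ad : A * d = 3 by rewrite /A; field; rewrite gt_eqF.
pose m : R := n.+1%:R.
pose C := expR (2 * A * sq x + 4 * m * A * d).
have C0 : 0 < C by exact: expR_gt0.
pose k := ep / 2 / C.
have k0 : 0 < k by exact: divr_gt0 (divr_gt0 ep0 _) C0.
pose th := ep / 2 / d.
have th0 : 0 < th by exact: divr_gt0 (divr_gt0 ep0 _) d0.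
pose B := growth_const K a b.
have B0 : 0 <= B by apply: growth_const_ge0 => //; rewrite a0.
(* The gap grows like exp (2 r / d) and the barrier like exp (3 r / d): at this
   squared radius the spare factor exp (r / d) absorbs the constant B / k. *)
pose r := Num.max (d * (B / k)) (Num.max d (sq x)).
have r1 : d * (B / k) <= r by rewrite le_max lexx.
have r2 : d <= r by rewrite !le_max lexx orbT.
have r3 : sq x <= r by rewrite !le_max lexx !orbT.
have [e [ae et1 ue]] : exists e, [/\ a < e, e < t1 &
    forall y, sq y <= r -> - th <= u y e].
  have := @near_initial_ge T u a r th cu _ ua th0.
  rewrite a0 (lt_trans ab bT) => /(_ isT) H.
  have : \forall e \near a^'+, [/\ a < e, e < t1 & forall y, sq y <= r -> - th <= u y e].
    near=> e; split; first by near: e; exact: nbhs_right_gt.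
      by near: e; exact: nbhs_right_lt.
    by move=> y yr; have : @cball R n.+1 r `<=` (fun y => - th <= u y e);
      [near: e|exact].
  by move=> /filter_ex.
have et : e <= t by lra.
pose z y s := gap u K e y s - (K + th) * (s - e).
have h : z x t <= k * expR (2 * A * sq x + 4 * n.+1%:R * A * (t - e)).
  apply: (@gauss_comparison R n r A e t k z) => //.
  - lra.
  - exact: ltW.
  - have : 16 * A * (t - e) <= 16 * A * (d / 48) by apply: ler_wpM2l; lra.
    lra.
  - have c1 := @gap_within _ _ _ _ _ _ _ (@cball R n.+1 r) e t hu hK ae et tb.
    have c2 : {within @cball R n.+1 r `*` `[e, t]%classic,
        continuous (fun p : 'rV[R]_n.+1 * R => (K + th) * (p.2 - e))}.
      apply: continuous_subspaceT => p.
      apply: (@continuous_time R _ (fun t => (K + th) * (t - e))) => s.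
      exact: der_continuous (derZ _ (derB (der_id s) (der_cst e s))).
    by move=> p; apply: cvgB; [exact: c1|exact: c2].
  - by move=> y _; rewrite /z /gap !subrr !mulr0 tint_point !subr0.
  - move=> y s yr /andP[es st].
    have h1 : 0 <= (K + th) * (s - e) by apply: mulr_ge0; lra.
    have [se|es'] := eqVneq s e.
      rewrite /z /gap se !subrr !mulr0 tint_point !subr0.
      by rewrite mulr_ge0 ?expR_ge0 ?ltW.
    have es2 : e < s by rewrite lt_neqAle eq_sym es'.
    have := gap_growth (x := y) hu hK ae es2; rewrite -/d yr => /(_ ltac:(lra) r2).
    rewrite -/B => h2.
    have h3 := exp_dominates k0 d0 B0 r1.
    have h4 : B * expR (2 * r / d) <= k * expR (r / d) * expR (2 * r / d).
      by apply: ler_wpM2r h3; exact: expR_ge0.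
    have h5 : k * expR (r / d) * expR (2 * r / d) = k * expR (A * r).
      rewrite -mulrA -expRD; congr (_ * expR _); rewrite /A.
      by field; rewrite gt_eqF.
    rewrite /z; lra.
  - move=> y s yr /andP[es st].
    have gd : is_derive s 1 (gap u K e y) (K - u y s).
      by apply: (gap_derive _ hu hK) => //; lra.
    have gl : is_lap (fun y => gap u K e y s) y
        (u y e - u y s + tint (fun s => expR (u y s)) e s).
      by apply: (gap_lap _ hu hK) => //; lra.
    exists ((K - u y s) - (K + th) * (1 - 0)),
      ((u y e - u y s + tint (fun s => expR (u y s)) e s) - 0); split.
    + exact: (derB gd (derZ (K + th) (derB (der_id s) (der_cst e s)))).
    + exact: (is_lapB gl (is_lap_cst ((K + th) * (s - e)) y)).
    + have := @gap_exp_bounds _ _ _ _ _ _ _ e y s hu hK ae ltac:(lra) ltac:(lra).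
      have := ue y (ltW yr); lra.
  - by rewrite et lexx.
have h1 : k * expR (2 * A * sq x + 4 * n.+1%:R * A * (t - e)) <= ep / 2.
  have -> : ep / 2 = k * C by rewrite /k; field; rewrite gt_eqF.
  rewrite ler_pM2l// ler_expR lerD2l; apply: ler_wpM2l; last lra.
  by apply: mulr_ge0 (ltW A0); apply: mulr_ge0 => //; exact: ler0n.
have h2 : th * (t - e) <= ep / 2.
  have -> : ep / 2 = th * d by rewrite /th; field; rewrite gt_eqF.
  by rewrite ler_pM2l//; lra.
have h3 : K * (t - e) <= K * (t - a) by apply: ler_wpM2l; lra.
have := gap_split x hu hK ae (c := t1) (t := t).
rewrite (ltW et1) t1t => /(_ isT tb) E.
have h4 : 0 <= gap u K e x t1 by apply: (gap_ge0 _ hu hK) => //; lra.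
move: h; rewrite /z E; lra.
Unshelve. all: by end_near. Qed.

(** Over a sliding window of length [h] the time integral of [K - u] is a bounded
    subsolution of the heat equation, so it keeps its initial upper bound.  That
    bound comes from [gap_le_elapsed] and tends to [K * h] as the window is
    started closer to [a]. *)
Lemma gap_le_window T u K a b x t h :
  entire_solution T u -> bounded_window T u K a b ->
  {within setT `*` [set` `[0, T[], continuous (fun z => u z.1 z.2)} ->
  (forall y, 0 <= u y a) ->
  let d := (b - a) / 2 in
  a < t -> 0 < h -> t + h <= a + d / 48 ->
  gap u K t x (t + h) <= K * h.
Proof.
move=> hu hK cu ua d at_ h0 td.
have [uC ueq u_rad] := hu; have [K0 /andP[a0 ab] bT uK uK0] := hK.
have d0 : 0 < d by rewrite /d; lra.
have tb : t + h <= b by rewrite /d in td; lra.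
have main t1 : a < t1 < t -> gap u K t x (t + h) <= K * (t1 + h - a).
  move=> /andP[at1 t1t].
  apply/ler_addgt0Pr => ep ep0.
  pose A := 3 / d; have A0 : 0 < A by rewrite divr_gt0.
  have Ad : A * d = 3 by rewrite /A; field; rewrite gt_eqF.
  pose C := expR (2 * A * sq x + 4 * n.+1%:R * A * (t - t1)).
  have C0 : 0 < C by exact: expR_gt0.
  pose k := ep / C; have k0 : 0 < k by exact: divr_gt0.
  have Kd0 : 0 <= K * d by rewrite mulr_ge0// ltW.
  pose r := Num.max (d * (K * d / k)) (sq x).
  have r1 : d * (K * d / k) <= r by rewrite le_max lexx.
  have r3 : sq x <= r by rewrite !le_max lexx !orbT.
  have r0 : 0 <= r by rewrite (le_trans (sq_ge0 x)).
  pose z y s := gap u K t1 y (s + h) - gap u K t1 y s - K * (t1 + h - a).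
  have zs y s : t1 <= s <= t ->
      z y s = gap u K s y (s + h) - K * (t1 + h - a).
    move=> /andP[t1s st]; rewrite /z.
    have := gap_split y hu hK at1 (c := s) (t := s + h).
    by rewrite t1s /= lerDl (ltW h0) => /(_ isT ltac:(lra)) ->; ring.
  have hz : z x t <= k * expR (2 * A * sq x + 4 * n.+1%:R * A * (t - t1)).
    apply: (@gauss_comparison R n r A t1 t k z) => //.
    - exact: ltW.
    - have : 16 * A * (t - t1) <= 16 * A * (d / 48) by apply: ler_wpM2l; lra.
      lra.
    - have c1 : {within @cball R n.+1 r `*` `[t1, t]%classic,
          continuous (fun p => gap u K t1 p.1 p.2)}.
        by apply: (gap_within hu hK) => //; lra.
      have c2 : {within @cball R n.+1 r `*` `[t1, t]%classic,
          continuous (fun p => gap u K t1 p.1 (p.2 + h))}.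
        apply: continuous_in_subspaceT => -[y s]; rewrite inE => -[_ /=].
        rewrite in_itv/= => /andP[t1s st].
        have sh : {for (y, s), continuous (fun p : 'rV[R]_n.+1 * R => (p.1, p.2 + h))}.
          apply: (@cvg_pair _ _ _ _ (nbhs y) (nbhs (s + h))).
            exact: (@cvg_fst _ _ (nbhs y) (nbhs s)).
          have cs : continuous (fun c : R => c + h).
            by move=> c; exact: der_continuous (derD (der_id c) (der_cst h c)).
          exact: (@continuous_time R 'rV[R]_n.+1 _ cs (y, s)).
        apply: (@continuous_comp _ _ _ (fun p : 'rV[R]_n.+1 * R => (p.1, p.2 + h))
          (fun p => gap u K t1 p.1 p.2)) => //.
        apply: cvgB.
          have cs : continuous (fun c : R => K * (c - t1)).
            by move=> c; exact: der_continuous (derZ _ (derB (der_id c) (der_cst t1 c))).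
          exact: (@continuous_time R 'rV[R]_n.+1 _ cs (y, s + h)).
        by apply: (@int_sol_at _ _ T u t1 y (s + h) hu); lra.
      by move=> p; apply: cvgB; [apply: cvgB; [exact: c2|exact: c1]|exact: cvg_cst].
    - move=> y _; rewrite (zs y t1) ?lexx ?(ltW t1t)// subr_le0.
      by apply: (gap_le_elapsed _ hu hK cu ua) => //; rewrite -?/d; lra.
    - move=> y s yr /andP[t1s st]; rewrite (zs y s) ?t1s//.
      have h1 : gap u K s y (s + h) <= K * (s + h - a).
        by apply: (gap_le_elapsed _ hu hK cu ua) => //; rewrite -?/d; lra.
      have h2 : K * (s + h - a) <= K * d by apply: ler_wpM2l; lra.
      have h3 := exp_dominates k0 d0 Kd0 r1.
      have h4 : k * expR (r / d) <= k * expR (A * r).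
        rewrite ler_pM2l// ler_expR /A mulrAC ler_pM2r ?invr_gt0//; lra.
      have h5 : 0 <= K * (t1 + h - a) by apply: mulr_ge0; lra.
      lra.
    - move=> y s yr /andP[t1s st].
      have gd1 : is_derive s 1 (gap u K t1 y) (K - u y s).
        by apply: (gap_derive _ hu hK) => //; lra.
      have gd2 : is_derive (s + h) 1 (gap u K t1 y) (K - u y (s + h)).
        by apply: (gap_derive _ hu hK) => //; lra.
      have gl1 : is_lap (fun y => gap u K t1 y s) y
          (u y t1 - u y s + tint (fun s => expR (u y s)) t1 s).
        by apply: (gap_lap _ hu hK) => //; lra.
      have gl2 : is_lap (fun y => gap u K t1 y (s + h)) y
          (u y t1 - u y (s + h) + tint (fun s => expR (u y s)) t1 (s + h)).
        by apply: (gap_lap _ hu hK) => //; lra.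
      have gd3 : is_derive s 1 (fun s => gap u K t1 y (s + h)) ((K - u y (s + h)) * (1 + 0)).
        exact: (@der_comp R (gap u K t1 y) (fun s => s + h) s _ _ gd2
          (derD (der_id s) (der_cst h s))).
      exists ((K - u y (s + h)) * (1 + 0) - (K - u y s) - 0); eexists; split.
      + exact: (derB (derB gd3 gd1) (der_cst (K * (t1 + h - a)) s)).
      + exact: (is_lapB (is_lapB gl2 gl1) (is_lap_cst (K * (t1 + h - a)) y)).
      + have := @gap_exp _ _ _ _ _ _ _ t1 y s (s + h) hu hK at1 ltac:(lra) ltac:(lra).
        by move=> /(_ ltac:(lra))[_]; lra.
    - by rewrite lexx ltW.
  have : k * C = ep by rewrite /k; field; rewrite gt_eqF.
  by move: hz; rewrite (zs x t) ?lexx ?(ltW t1t)// -/C; lra.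
apply/ler_addgt0Pr => ep ep0.
pose q := Num.min (ep / (K + 1)) ((t - a) / 2).
have K1 : 0 < K + 1 by lra.
have q0 : 0 < q by rewrite lt_min !divr_gt0 ?subr_gt0.
have q1 : q <= ep / (K + 1) by rewrite ge_min lexx.
have q2 : q <= (t - a) / 2 by rewrite ge_min lexx orbT.
have := main (a + q) ltac:(lra).
have : K * q <= ep.
  have : (K + 1) * q <= ep by rewrite mulrC -ler_pdivlMr.
  lra.
lra.
Qed.

(** Averages of [u] over short time windows are nonnegative by [gap_le_window]. *)
Lemma nonneg_step T u K a b :
  entire_solution T u -> bounded_window T u K a b ->
  {within setT `*` [set` `[0, T[], continuous (fun z => u z.1 z.2)} ->
  (forall y, 0 <= u y a) ->
  forall x t, a < t < a + (b - a) / 96 -> 0 <= u x t.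
Proof.
move=> hu hK cu ua x t /andP[at_ tb].
have [uC ueq u_rad] := hu; have [K0 /andP[a0 ab] bT uK uK0] := hK.
rewrite leNgt; apply/negP => ut.
have ct : {for t, continuous (u x)}.
  have c : cont_on (u x) t t by apply: (sol_cont_on uC (e := t)); lra.
  by apply: c; rewrite lexx.
have [h [h0 th hu0]] : exists h, [/\ 0 < h, t + h <= a + (b - a) / 96 &
    forall s, t <= s <= t + h -> u x s <= u x t / 2].
  move/cvgr_le : ct => /(_ (u x t / 2) ltac:(lra)) /nbhs_ballP[e /= e0 be].
  exists (Num.min (e / 2) (a + (b - a) / 96 - t)); split.
  - by rewrite lt_min divr_gt0// subr_gt0.
  - by rewrite -lerBrDl ge_min lexx orbT.
  - move=> s /andP[ts se]; apply: be; rewrite /ball/= distrC ger0_norm ?subr_ge0//.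
    have : Num.min (e / 2) (a + (b - a) / 96 - t) <= e / 2 by rewrite ge_min lexx.
    lra.
have := @gap_le_window T u K a b x t h hu hK cu ua at_ h0 ltac:(lra).
rewrite /gap [t + h - t]addrAC subrr add0r => H.
have : tint (u x) t (t + h) <= u x t / 2 * (t + h - t).
  rewrite -tint_cst; [|lra]; apply: tint_le => //.
  - by apply: (sol_cont_on uC (e := t)); lra.
  - by move=> s _; exact: cvg_cst.
nra.
Qed.

(** Each application of [nonneg_step] covers a time span that depends only on the
    distance to [T], so nonnegativity cannot stop at a time before [T]. *)
Lemma entire_nonneg T u :
  entire_solution T u ->
  {within setT `*` [set` `[0, T[], continuous (fun z => u z.1 z.2)} ->
  (forall x, 0 <= u x 0) ->
  (forall x t, 0 < t < T -> u x t <= u 0 t) ->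
  (forall t, t < T -> exists M, forall s, 0 < s <= t -> `|u 0 s| <= M) ->
  forall x t, 0 < t < T -> 0 <= u x t.
Proof.
move=> hu cu u0 umax ub x t /andP[t0 tT].
have [uC ueq u_rad] := hu.
pose S := [set s | 0 <= s <= t /\ forall y c, 0 <= c <= s -> 0 <= u y c].
have S0 : S 0.
  split; first by rewrite lexx ltW.
  by move=> y c c0; have -> : c = 0 by apply/le_anti; rewrite andbC.
have hS : has_sup S by split; [exists 0 | exists t => s [/andP[]]].
pose a := sup S.
have a0 : 0 <= a by apply: ub_le_sup => //; case: hS.
have at_ : a <= t by apply: ge_sup; [exists 0|move=> s [/andP[]]].
have below y c : 0 <= c < a -> 0 <= u y c.
  move=> /andP[c0 ca]; have [s [_ Ss] cs] := sup_adherent (eps := a - c) ltac:(lra) hS.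
  by apply: Ss; rewrite c0/=; rewrite -/a in cs; lra.
have at_a y : 0 <= u y a.
  have [->//|an0] := eqVneq a 0.
  have ap : 0 < a by rewrite lt_neqAle eq_sym an0.
  rewrite leNgt; apply/negP => uya.
  have ca : {for a, continuous (u y)}.
    have c : cont_on (u y) a a by apply: (sol_cont_on uC (e := a)); lra.
    by apply: c; rewrite lexx.
  move/cvgr_lt : ca => /(_ 0 uya) /nbhs_ballP[e /= e0 be].
  pose h := Num.min (e / 2) a.
  have h0 : 0 < h by rewrite lt_min divr_gt0.
  have h1 : h <= e / 2 by rewrite ge_min lexx.
  have h2 : h <= a by rewrite ge_min lexx orbT.
  have := below y (a - h) ltac:(lra); rewrite leNgt => /negP; apply; apply: be.
  by rewrite /ball /= opprB addrC subrK gtr0_norm//; lra.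
have [|at'] := eqVneq a t; first by move=> <-.
have alt : a < t by rewrite lt_neqAle at'.
pose b := (a + T) / 2.
have [M hM] := ub b ltac:(rewrite /b; lra).
have M0 : 0 <= M by apply: le_trans (hM b _); [exact: normr_ge0|rewrite /b; lra].
have hK : bounded_window T u M a b.
  split => //.
  - by rewrite a0/= /b; lra.
  - by rewrite /b; lra.
  - move=> y s sb; apply: le_trans (umax _ _ _) _; first by rewrite /b in sb; lra.
    exact: le_trans (ler_norm _) (hM s sb).
  - by move=> s /hM; rewrite ler_norml => /andP[].
have step := nonneg_step hu hK cu at_a.
pose s := Num.min t (a + (b - a) / 192).
have ba : 0 < b - a by rewrite /b; lra.
have sa : a < s by rewrite lt_min alt/=; lra.
have st : s <= t by rewrite ge_min lexx.
have sb : s <= a + (b - a) / 192 by rewrite ge_min lexx orbT.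
suff : S s.
  move=> Ss; have : s <= a by apply: ub_le_sup => //; case: hS.
  by rewrite leNgt sa.
split; first by lra.
move=> y c /andP[c0 cs]; have [ca|ac] := ltP c a; first by apply: below; rewrite c0.
have [->//|cna] := eqVneq c a.
by apply: step; rewrite lt_neqAle eq_sym cna ac/=; lra.
Qed.

End whole_space_nonneg.

(** * Stationary bubbles *)

Section bubble.
Context {R : realType}.
Implicit Types (al r t : R) (x y : 'rV[R]_2).

(** The radial solutions of Liouville's equation on the plane, where the sum of
    the Laplacian and the exponential vanishes; [al] is the height at the
    origin. *)
Definition bubble al x : R := al - 2 * ln (1 + expR al / 8 * sq x).

Lemma bubble_arg_gt0 al (q : R) : 0 <= q -> 0 < 1 + expR al / 8 * q.
Proof.
move=> q0; have : 0 <= expR al / 8 * q by rewrite mulr_ge0// divr_ge0// expR_ge0.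
lra.
Qed.

Lemma bubble0 al : bubble al 0 = al.
Proof. by rewrite /bubble sq0 mulr0 addr0 ln1 mulr0 subr0. Qed.

Lemma bubble_le al x y : sq x <= sq y -> bubble al y <= bubble al x.
Proof.
move=> xy; rewrite /bubble lerD2l lerN2 ler_pM2l// ler_ln ?posrE;
  [|by apply: bubble_arg_gt0; exact: sq_ge0..].
by rewrite lerD2l ler_wpM2l// divr_ge0// expR_ge0.
Qed.

Lemma bubble_le_top al x : bubble al x <= al.
Proof. by rewrite -[leRHS]bubble0; apply: bubble_le; rewrite sq0 sq_ge0. Qed.

Lemma expR_bubble al x :
  expR (bubble al x) = expR al / (1 + expR al / 8 * sq x) ^+ 2.
Proof.
have q0 := bubble_arg_gt0 al (sq_ge0 x).
rewrite /bubble expRB; congr (_ / _).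
by rewrite mulr_natl mulr2n expRD lnK ?posrE// -expr2.
Qed.

Lemma bubble_lap al x : is_lap (bubble al) x (- expR (bubble al x)).
Proof.
pose c := expR al / 8; have c0 : 0 < c by rewrite divr_gt0// expR_gt0.
have dg (q : R) : 0 < 1 + c * q ->
    is_derive q 1 (fun q => al - 2 * ln (1 + c * q)) (- (2 * c * (1 + c * q)^-1)).
  move=> q0.
  apply: der_eq (derB (der_cst al q) (derZ 2 (@der_ln _ (fun q => 1 + c * q)
    q _ q0 (derD (der_cst 1 q) (derZ c (der_id q)))))) _.
  ring.
have sx0 : 0 < 1 + c * sq x by apply: bubble_arg_gt0; exact: sq_ge0.
have := @is_lap_sq R 1 (fun q => al - 2 * ln (1 + c * q))
  (fun q => - (2 * c * (1 + c * q)^-1))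
  (2 * c ^+ 2 / (1 + c * sq x) ^+ 2) x.
rewrite expR_bubble -/c.
have -> : - (expR al / (1 + c * sq x) ^+ 2) =
    2 * 2%:R * - (2 * c * (1 + c * sq x)^-1) +
    4 * sq x * (2 * c ^+ 2 / (1 + c * sq x) ^+ 2).
  have -> : expR al = 8 * c by rewrite /c; field.
  by field; rewrite gt_eqF.
apply.
  near=> q; apply: dg; near: q.
  have : {for sq x, continuous (fun q => 1 + c * q)}.
    exact: der_continuous (derD (der_cst 1 (sq x)) (derZ c (der_id (sq x)))).
  by move/cvgr_gt; apply.
apply: der_eq (derN (derZ (2 * c) (@der_inv _ (fun q => 1 + c * q) (sq x) _
  (negbT (gt_eqF sx0)) (derD (der_cst 1 (sq x)) (derZ c (der_id (sq x))))))) _.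
by field; rewrite gt_eqF.
Unshelve. all: by end_near. Qed.

(** The inequality [- ln z >= 1 - z], applied to the quotient of the arguments of
    the two logarithms. *)
Lemma bubble_steep al r x y : sq x <= sq y -> sq y <= r ->
  2 * (expR al / 8) / (1 + expR al / 8 * r) * (sq y - sq x) <=
  bubble al x - bubble al y.
Proof.
move=> xy yr; set c := expR al / 8.
have c0 : 0 < c by rewrite divr_gt0// expR_gt0.
have X0 : 0 < 1 + c * sq x by apply: bubble_arg_gt0; exact: sq_ge0.
have Y0 : 0 < 1 + c * sq y by apply: bubble_arg_gt0; exact: sq_ge0.
have r0 : 0 < 1 + c * r.
  by apply: bubble_arg_gt0; rewrite (le_trans _ yr)// sq_ge0.
have -> : bubble al x - bubble al y = 2 * - ln ((1 + c * sq x) / (1 + c * sq y)).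
  by rewrite /bubble ln_div ?posrE// -/c; ring.
have h : ln ((1 + c * sq x) / (1 + c * sq y)) <= - (c * (sq y - sq x) / (1 + c * sq y)).
  have -> : (1 + c * sq x) / (1 + c * sq y) =
      1 + - (c * (sq y - sq x) / (1 + c * sq y)).
    by field; rewrite gt_eqF.
  apply: le_ln1Dx.
  rewrite ltrN2 ltr_pdivrMr//; lra.
have h2 : c * (sq y - sq x) / (1 + c * r) <= c * (sq y - sq x) / (1 + c * sq y).
  apply: ler_wpM2l; first by rewrite mulr_ge0 ?subr_ge0// ltW.
  by rewrite lef_pV2 ?posrE// lerD2l ler_pM2l.
have -> : 2 * c / (1 + c * r) * (sq y - sq x) = 2 * (c * (sq y - sq x) / (1 + c * r)).
  by field; rewrite gt_eqF.
by rewrite ler_pM2l//; lra.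
Qed.

End bubble.

(** * Crossings of a solution with a bubble *)

Definition local_solution (R : realType) (r t0 T : R) (u : 'rV[R]_2 -> R -> R) : Prop :=
  forall x t, sq x <= r -> t0 <= t < T ->
    {for (x, t), continuous (fun z => u z.1 z.2)} /\
    exists2 l, is_lap (u ^~ t) x l & is_derive t 1 (u x) (l + expR (u x t)).

Section bubble_crossing.
Context {R : realType}.
Implicit Types (al r t T : R) (x y : 'rV[R]_2) (u : 'rV[R]_2 -> R -> R).

Lemma near_left (t0 t : R) (P : R -> Prop) : t0 < t -> (\forall s \near t, P s) ->
  exists2 s0, t0 <= s0 < t & forall s, s0 < s < t -> P s.
Proof.
move=> t0t /nbhs_ballP[e /= e0 be].
exists (Num.max t0 (t - e)).
  by rewrite le_max lexx/= gt_max t0t/= ltrBlDr ltrDl.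
move=> s /andP[]; rewrite gt_max => /andP[_ s1] s2; apply: be.
by rewrite /ball/= gtr0_norm ?subr_gt0//; lra.
Qed.

Lemma continuous_comp2 (Q X Y Z : topologicalType) (f : Q -> X) (g : Q -> Y)
    (F : X * Y -> Z) (q : Q) :
  {for q, continuous f} -> {for q, continuous g} ->
  {for (f q, g q), continuous F} -> {for q, continuous (fun q => F (f q, g q))}.
Proof.
move=> cf cg cF; apply: (@cvg_comp _ _ _ (fun q => (f q, g q)) F (nbhs q)
  (nbhs (f q, g q))); last exact: cF.
exact: (@cvg_pair _ _ _ _ (nbhs (f q)) (nbhs (g q)) _ _ _ f g cf cg).
Qed.

Lemma continuous_fst (X Y : topologicalType) (q : X * Y) :
  {for q, continuous (fun q : X * Y => q.1)}.
Proof. by case: q => x y; exact: (@cvg_fst _ _ (nbhs x) (nbhs y)). Qed.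

Lemma continuous_snd (X Y : topologicalType) (q : X * Y) :
  {for q, continuous (fun q : X * Y => q.2)}.
Proof. by case: q => x y; exact: (@cvg_snd _ _ (nbhs x) (nbhs y)). Qed.

Lemma bubble_continuous al : continuous (@bubble R al).
Proof.
move=> x; pose g q := al - 2 * ln (1 + expR al / 8 * q).
have q0 := bubble_arg_gt0 al (sq_ge0 x).
have dg := derB (der_cst al (sq x)) (derZ 2 (@der_ln _ (fun q => 1 + expR al / 8 * q)
    (sq x) _ q0 (derD (der_cst 1 (sq x)) (derZ (expR al / 8) (der_id (sq x)))))).
apply: (@cvg_comp _ _ _ (@sq R 2) g (nbhs x) (nbhs (sq x)) (nbhs (g (sq x)))).
  exact: sq_continuous.
exact: der_continuous dg.
Qed.

Lemma min0_sub_neq (a p : R) : 0 < p -> a <> Num.min a 0 - p.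
Proof. by move=> p0; case: (ltP a 0) => h E; lra. Qed.

Lemma min0_le_neg (a b : R) : Num.min a 0 <= b -> b < 0 -> a <= b.
Proof. by case: (ltP a 0) => h ? ?; lra. Qed.

Lemma min0_lt_neg (a b : R) : Num.min a 0 < b -> b <= 0 -> a < b.
Proof. by case: (ltP a 0) => h ? ?; lra. Qed.

(** A maximum principle for pairs of points stands in for the theory of sign
    changes.  Write [w] for [u - bubble al] and [p] for a positive, exponentially
    growing perturbation, and consider the first time at which
    [w y - min (w x) 0 + p] vanishes for some [|x| <= |y|].  There [y] is interior
    because [w] is positive on the boundary, and [|x| < |y|] because [w] is
    radial; so [y] minimizes [w] locally and [x] maximizes [min w 0] locally.
    When [w x < 0], the reaction terms [exp bubble * (exp w - 1)] are ordered the
    right way because bubbles decrease in [|x|] while [exp w - 1] is negative. *)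
Lemma crossing_ordered T u r t0 al :
  local_solution r t0 T u ->
  (forall x y t, sq x <= r -> t0 <= t < T -> sq x = sq y -> u x t = u y t) ->
  (forall x t, sq x = r -> t0 <= t < T -> bubble al x < u x t) ->
  (forall x y, sq x <= sq y -> sq y <= r ->
    u x t0 - bubble al x <= u y t0 - bubble al y) ->
  forall t x y, t0 <= t < T -> sq x <= sq y -> sq y <= r ->
    Num.min (u x t - bubble al x) 0 <= u y t - bubble al y.
Proof.
move=> sol rad bdry init t1 x1 y1 /andP[t01 t1T] xy1 y1r.
rewrite leNgt; apply/negP => bad.
pose w x t := u x t - bubble al x.
pose L := expR al + 1.
have L0 : 0 < L by have := expR_gt0 al; rewrite /L; lra.
pose E := expR (L * (t1 - t0)); have E0 : 0 < E by exact: expR_gt0.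
pose k := (Num.min (w x1 t1) 0 - w y1 t1) / E.
have k0 : 0 < k by apply: divr_gt0 => //; rewrite subr_gt0.
pose p s := k * expR (L * (s - t0)).
have p0 s : 0 < p s by apply: mulr_gt0 => //; exact: expR_gt0.
have dp (s : R) : is_derive s 1 p (L * p s).
  by apply: der_eq (is_derive_expl L k t0 s) _; rewrite /p; ring.
pose K := [set q : 'rV[R]_2 * 'rV[R]_2 | sq q.1 <= sq q.2 /\ sq q.2 <= r].
have csq1 : continuous (fun q : 'rV[R]_2 * 'rV[R]_2 => sq q.1).
  move=> q; apply: (@cvg_comp _ _ _ fst (@sq R 2) (nbhs q) (nbhs q.1) (nbhs (sq q.1))).
    exact: (@cvg_fst _ _ (nbhs q.1) (nbhs q.2)).
  exact: sq_continuous.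
have csq2 : continuous (fun q : 'rV[R]_2 * 'rV[R]_2 => sq q.2).
  move=> q; apply: (@cvg_comp _ _ _ snd (@sq R 2) (nbhs q) (nbhs q.2) (nbhs (sq q.2))).
    exact: (@cvg_snd _ _ (nbhs q.1) (nbhs q.2)).
  exact: sq_continuous.
have cK : compact K.
  have cc : compact (@cball R 2 r `*` @cball R 2 r).
    by apply: compact_setX; exact: cball_compact.
  apply: subclosed_compact cc _.
    have -> : K = ((fun q => sq q.1 - sq q.2) @^-1` [set v | v <= 0]) `&`
        ((fun q => sq q.2) @^-1` [set v | v <= r]).
      by apply/seteqP; split => q [/= h1 h2]; split => //=; move: h1; rewrite subr_le0.
    apply: closedI; last by apply: (closed_comp _ (@closed_le _ r)) => q _; exact: csq2.
    apply: (closed_comp _ (@closed_le _ (0 : R))) => q _.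
    by apply: cvgB; [exact: csq1|exact: csq2].
  by move=> q [q1 q2]; split => //=; exact: le_trans q1 q2.
have cu x t : sq x <= r -> t0 <= t < T -> {for (x, t), continuous (fun z => w z.1 z.2)}.
  move=> xr tt; have [c _] := sol x t xr tt.
  have cb := @continuous_space R _ _ (@bubble_continuous al) (x, t).
  exact: (cvgB c cb).
have cz : {within K `*` `[t0, t1]%classic, continuous (fun q : ('rV[R]_2 * 'rV[R]_2) * R =>
    w q.1.2 q.2 - Num.min (w q.1.1 q.2) 0 + p q.2)}.
  apply: continuous_in_subspaceT => -[[x y] s]; rewrite inE => -[[/= xy yr]].
  rewrite in_itv/= => /andP[s0 s1].
  have sT : t0 <= s < T by rewrite s0 (le_lt_trans s1).
  have c1 : {for ((x, y), s), continuous (fun q : ('rV[R]_2 * 'rV[R]_2) * R => q.1.1)}.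
    by apply: (@continuous_comp _ _ _ fst fst); exact: continuous_fst.
  have c2 : {for ((x, y), s), continuous (fun q : ('rV[R]_2 * 'rV[R]_2) * R => q.1.2)}.
    by apply: (@continuous_comp _ _ _ fst snd); [exact: continuous_fst|exact: continuous_snd].
  have cw1 : {for ((x, y), s), continuous (fun q : ('rV[R]_2 * 'rV[R]_2) * R => w q.1.1 q.2)}.
    apply: (@continuous_comp2 _ _ _ _ (fun q : ('rV[R]_2 * 'rV[R]_2) * R => q.1.1)
      (fun q => q.2) (fun z => w z.1 z.2)).
    - exact: c1.
    - exact: continuous_snd.
    - exact: cu (le_trans xy yr) sT.
  have cw2 : {for ((x, y), s), continuous (fun q : ('rV[R]_2 * 'rV[R]_2) * R => w q.1.2 q.2)}.
    apply: (@continuous_comp2 _ _ _ _ (fun q : ('rV[R]_2 * 'rV[R]_2) * R => q.1.2)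
      (fun q => q.2) (fun z => w z.1 z.2)).
    - exact: c2.
    - exact: continuous_snd.
    - exact: cu yr sT.
  have cp : continuous (fun q : ('rV[R]_2 * 'rV[R]_2) * R => p q.2).
    by apply: continuous_time => c; exact: der_continuous (dp c).
  have cm := @continuous_min R _ (fun q : ('rV[R]_2 * 'rV[R]_2) * R => w q.1.1 q.2)
    (cst 0) ((x, y), s) cw1 (cvg_cst _).
  by apply: cvgD; [apply: cvgB; [exact: cw2|exact: cm]|exact: cp].
have [||[x y] [t [[/= xy yr] /andP[t0t tt1] zt zbefore zat]]] :=
    @first_touch R _ K t0 t1 (fun q s => w q.2 s - Num.min (w q.1 s) 0 + p s) cK cz.
- move=> [x y] [/= xy yr]; have := init x y xy yr; rewrite -!/(w _ _) => wxy.
  have : Num.min (w x t0) 0 <= w x t0 by rewrite ge_min lexx.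
  have := p0 t0; lra.
- exists (x1, y1), t1; split => //=; first by rewrite t01 lexx.
  have -> : p t1 = Num.min (w x1 t1) 0 - w y1 t1.
    by rewrite /p -/E /k; field; rewrite gt_eqF.
  lra.
have tT : t0 <= t < T by rewrite (ltW t0t) (le_lt_trans tt1).
have wy : w y t = Num.min (w x t) 0 - p t by move: zt => /=; lra.
have pt := p0 t.
have min0 : Num.min (w x t) 0 <= 0 by rewrite ge_min lexx orbT.
have y_lt : sq y < r.
  rewrite lt_neqAle yr andbT; apply/eqP => yE.
  by have := bdry y t yE tT; move: wy; rewrite {1}/w; lra.
have x_lt : sq x < sq y.
  rewrite lt_neqAle xy andbT; apply/eqP => xE.
  have wxy : w x t = w y t.
    rewrite /w (rad x y t (le_trans xy yr) tT xE); congr (_ - _).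
    by apply/le_anti; rewrite !bubble_le// xE.
  by move: wy; rewrite wxy => /(min0_sub_neq pt).
have [_ [ly uly udy]] := sol y t yr tT.
have [_ [lx ulx udx]] := sol x t (le_trans xy yr) tT.
have wly := is_lapB uly (bubble_lap al y).
have wlx := is_lapB ulx (bubble_lap al x).
have wdy : is_derive t 1 (w y) (ly + expR (u y t)).
  by apply: der_eq (derB udy (der_cst (bubble al y) t)) _; rewrite subr0.
have wdx : is_derive t 1 (w x) (lx + expR (u x t)).
  by apply: der_eq (derB udx (der_cst (bubble al x) t)) _; rewrite subr0.
have ly0 : 0 <= ly - - expR (bubble al y).
  apply: is_lap_min wly _; near=> y'.
  have y'r : sq y' <= r by apply: ltW; near: y'; exact: near_sq_lt.
  have y'x : sq x <= sq y'.
    apply: ltW; near: y'; have := @sq_continuous R 2 y.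
    by move/cvgr_gt; apply.
  have := zat (x, y') (conj y'x y'r); rewrite /= -!/(w _ _) wy; lra.
have ey : expR (u y t) - expR (bubble al y) = expR (bubble al y) * (expR (w y t) - 1).
  by rewrite mulrBr mulr1 -expRD /w addrCA subrr addr0.
have ex : expR (u x t) - expR (bubble al x) = expR (bubble al x) * (expR (w x t) - 1).
  by rewrite mulrBr mulr1 -expRD /w addrCA subrr addr0.
have by0 := expR_gt0 (bubble al y).
have byal : expR (bubble al y) <= expR al by rewrite ler_expR bubble_le_top.
have bxy : expR (bubble al y) <= expR (bubble al x) by rewrite ler_expR bubble_le.
have ptal : expR (bubble al y) * p t <= expR al * p t by rewrite ler_pM2r.
have [s0 /andP[s00 s0t] pos] : exists2 s0, t0 <= s0 < t & forall s, s0 < s < t ->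
    forall x', sq x' <= sq y -> 0 < w y s - Num.min (w x' s) 0 + p s.
  exists t0; first by rewrite lexx.
  move=> s /andP[s1 s2] x' x'y; apply: (zbefore (x', y)) => //.
  by rewrite (ltW s1).
have slice v : sq v <= r -> {for t, continuous (w v)}.
  by move=> vr; exact: (continuous_slice (f := fun z => w z.1 z.2) (cu v t vr tT)).
case: (ltrgtP (w x t) 0) => wx.
(* Near x the minimum with 0 is w itself, so x maximizes w. *)
-   have wyx : w y t = w x t - p t by rewrite wy min_l// ltW.
  have lx0 : lx - - expR (bubble al x) <= 0.
    apply: is_lap_max wlx _; near=> x'.
    have x'y : sq x' <= sq y by apply: ltW; near: x'; exact: near_sq_lt.
    have := zat (x', y) (conj x'y yr); rewrite /= -!/(w _ _) wyx => z0.
    apply: (min0_le_neg _ wx).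
    by move: z0; rewrite addrAC subrK subr_ge0.
  have [s1 /andP[s10 s1t] neg] : exists2 s1, s0 <= s1 < t & forall s, s1 < s < t -> w x s < 0.
    apply: near_left => //; have := slice x (le_trans xy yr).
    by move/cvgr_lt; apply.
  have : (ly + expR (u y t) - (lx + expR (u x t))) + L * p t <= 0.
    apply: (is_derive_min_left (derD (derB wdy wdx) (dp t)) s1t) => s /andP[s1s st].
    have -> : w y t - w x t + p t = 0 by rewrite wyx; ring.
    have := pos s _ x xy; rewrite (le_lt_trans s10 s1s) st => /(_ isT).
    by rewrite min_l; [lra|apply/ltW/neg; rewrite s1s].
  have ewx : expR (w x t) <= 1 by rewrite -expR0 ler_expR ltW.
  have h1 : expR (bubble al x) * (expR (w x t) - 1) <= expR (bubble al y) * (expR (w x t) - 1).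
    by rewrite ler_wnM2r// subr_le0.
  have h2 : expR (w x t) - expR (w y t) <= p t.
    have -> : expR (w y t) = expR (w x t) * expR (- p t) by rewrite -expRD wyx.
    have := expR_ge1Dx (- p t); have := expR_gt0 (w x t); nra.
  have h3 : expR (bubble al y) * (expR (w x t) - expR (w y t)) <= expR (bubble al y) * p t.
    by rewrite ler_pM2l.
  rewrite /L; lra.
(* The minimum with 0 vanishes near (x, t), and only w y is involved. *)
-   have wyp : w y t = - p t by rewrite wy min_r ?ltW// sub0r.
  have [s1 /andP[s10 s1t] gt] : exists2 s1, s0 <= s1 < t & forall s, s1 < s < t -> 0 < w x s.
    apply: near_left => //; have := slice x (le_trans xy yr).
    by move/cvgr_gt; apply.
  have : (ly + expR (u y t)) + L * p t <= 0.
    apply: (is_derive_min_left (derD wdy (dp t)) s1t) => s /andP[s1s st].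
    have -> : w y t + p t = 0 by rewrite wyp; ring.
    have := pos s _ x xy; rewrite (le_lt_trans s10 s1s) st => /(_ isT).
    by rewrite min_r; [lra|apply/ltW/gt; rewrite s1s].
  have h2 : 1 - expR (w y t) <= p t by have := expR_ge1Dx (- p t); rewrite wyp; lra.
  have h3 : expR (bubble al y) * (1 - expR (w y t)) <= expR (bubble al y) * p t.
    by rewrite ler_pM2l.
  rewrite /L; lra.
(* Here min (w x) 0 has a kink.  The derivative be of w y + p is positive, so
   w y + p is negative just before t, and there w x' is below it for every
   |x'| <= |y|.  Hence w x' <= 0 at time t, x is a maximum of w, and w x, which
   lies below w y + p before t and meets it at t, has derivative at least be;
   but the equation makes this derivative nonpositive. *)
- have wyp : w y t = - p t by rewrite wy min_r ?wx// sub0r.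
  have h2 : 1 - expR (w y t) <= p t by have := expR_ge1Dx (- p t); rewrite wyp; lra.
  have h3 : expR (bubble al y) * (1 - expR (w y t)) <= expR (bubble al y) * p t.
    by rewrite ler_pM2l.
  pose be := ly + expR (u y t) + L * p t.
  have be0 : 0 < be by rewrite /be /L; lra.
  have db : is_derive t 1 (fun s => w y s + p s) be by exact: derD wdy (dp t).
  have [e e0 He] := is_derive_gt0 db be0.
  pose s1 := Num.max s0 (t - e).
  have s1t : s1 < t by rewrite gt_max s0t/= ltrBlDr ltrDl.
  have below s x' : s1 < s < t -> sq x' <= sq y -> w x' s < w y s + p s /\ w y s + p s < 0.
    rewrite gt_max => /andP[/andP[s0s es] st] x'y.
    have := He (t - s); rewrite subKr subr_gt0 st/= ltrBlDl -ltrBlDr es => /(_ isT)/andP[].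
    rewrite wyp addNr => bs _; split => //; apply: (min0_lt_neg _ (ltW bs)).
    have := pos s _ x' x'y; rewrite s0s st => /(_ isT).
    by rewrite addrAC subr_gt0.
  have le0 x' : sq x' <= sq y -> w x' t <= 0.
    move=> x'y; rewrite leNgt; apply/negP => gt0.
    have [s2 /andP[s12 s2t] Hs] : exists2 s2, s1 <= s2 < t & forall s, s2 < s < t -> 0 < w x' s.
      apply: near_left => //; have := slice x' (le_trans x'y yr).
      by move/cvgr_gt; apply.
    have m1 : s2 < (s2 + t) / 2 by rewrite midf_lt.
    have m2 : (s2 + t) / 2 < t by rewrite midf_lt.
    have pos2 : 0 < w x' ((s2 + t) / 2) by apply: Hs; rewrite m1 m2.
    have [|h4 h5] := below ((s2 + t) / 2) x' _ x'y; first by rewrite (le_lt_trans s12 m1).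
    by have := lt_trans pos2 (lt_trans h4 h5); rewrite ltxx.
  have lx0 : lx - - expR (bubble al x) <= 0.
    apply: is_lap_max wlx _; near=> x'.
    rewrite -!/(w _ _) wx; apply: le0; apply: ltW; near: x'; exact: near_sq_lt.
  have : be - (lx + expR (u x t)) <= 0.
    apply: (is_derive_min_left (derB db wdx) s1t) => s st.
    have [h _] := below s x st xy.
    by rewrite wyp wx addNr subr0 subr_ge0 ltW.
  move: ex; rewrite wx expR0 subrr mulr0; lra.
Unshelve. all: by end_near. Qed.

End bubble_crossing.

(** * Growth of the maximum *)

(** The maximum over a ball is attained on its boundary sphere, on which [f] is
    constant. *)
Lemma radial_subharmonic_ndecr (R : realType) n (r : R) (f : 'rV[R]_n.+1 -> R) :
  {within cball r, continuous f} ->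
  (forall x y, sq x <= r -> sq x = sq y -> f x = f y) ->
  (forall x, sq x < r -> exists2 l, is_lap f x l & 0 < l) ->
  forall x y, sq x <= sq y -> sq y <= r -> f x <= f y.
Proof.
move=> cf rad lap x y xy yr.
have cf' : {within cball (sq y), continuous f}.
  by apply: continuous_subspaceW cf => z /= zy; exact: le_trans yr.
have [|c] := compact_EVT_max _ (@cball_compact R n.+1 (sq y)) cf'.
  by exists y; exact: lexx.
rewrite inE /= => cy cmax.
have fxc : f x <= f c by apply: cmax; rewrite inE.
have [cE|cn] := eqVneq (sq c) (sq y); first by rewrite -(rad c y)// cE.
have clt : sq c < sq y by rewrite lt_neqAle cn.
have [l lc l0] := lap c (lt_le_trans clt yr).
suff : l <= 0 by rewrite leNgt l0.
apply: is_lap_max lc _; near=> z; apply: cmax; rewrite inE /=.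
by apply: ltW; near: z; exact: near_sq_lt.
Unshelve. all: by end_near. Qed.

Lemma is_lap_sqE (R : realType) n (x : 'rV[R]_n.+1) : is_lap (@sq R n.+1) x (2 * n.+1%:R).
Proof.
have h1 : \forall q \near sq x, is_derive (q : R) 1 (fun q : R => q) 1.
  by near=> q; exact: der_id.
have := @is_lap_sq R n _ (fun=> 1) 0 x h1 (der_cst 1 (sq x)).
by rewrite mulr1 mulr0 addr0.
Unshelve. all: by end_near. Qed.

Section bubble_growth.
Context {R : realType}.
Implicit Types (al r t T : R) (x y : 'rV[R]_2) (u : 'rV[R]_2 -> R -> R).

Definition bubble_barrier r t0 T al0 u : Prop :=
  [/\ local_solution r t0 T u,
    forall al x t, al0 <= al -> sq x = r -> t0 <= t < T -> bubble al x < u x t &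
    forall al t y, al0 <= al -> t0 <= t < T -> al <= u 0 t -> sq y <= r ->
      bubble al y <= u y t].

Lemma local_solution_within T r q t0 t1 t2 u :
  local_solution r t0 T u -> q <= r -> t0 <= t1 -> t2 < T ->
  {within @cball R 2 q `*` `[t1, t2]%classic, continuous (fun z => u z.1 z.2)}.
Proof.
move=> sol qr t01 t2T; apply: continuous_in_subspaceT => -[y s]; rewrite inE => -[/= yr].
rewrite in_itv/= => /andP[s1 s2].
by have [] := sol y s (le_trans yr qr) ltac:(lra).
Qed.

Lemma bubble_within A q t1 t2 :
  {within @cball R 2 q `*` `[t1, t2]%classic, continuous (fun z => bubble A z.1)}.
Proof.
by apply: continuous_subspaceT => z; exact: (@continuous_space R _ _ (@bubble_continuous R A) z).
Qed.

(** By [bubble_barrier] the bubble is below [u] at time [t] and, at all later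
    times, on the boundary of the ball; both are solutions, so they stay
    ordered. *)
Lemma bubble_persists r t0 T al0 u al t t' y :
  bubble_barrier r t0 T al0 u -> al0 <= al -> t0 <= t -> t <= t' -> t' < T ->
  al <= u 0 t -> sq y <= r -> bubble al y <= u y t'.
Proof.
move=> [sol bdry above] al0al t0t tt' t'T alu yr.
have : 0 <= u y t' - bubble al y.
  apply: (@comparison R 1 r t t' (expR al) (fun y s => u y s - bubble al y)) => //.
  - have c1 := @local_solution_within T r r t0 t t' u sol (lexx _) t0t t'T.
    have c2 := @bubble_within al r t t'.
    by move=> p; apply: cvgB; [exact: c1|exact: c2].
  - by move=> x xr; rewrite subr_ge0; apply: above => //; lra.
  - by move=> x s xr ss; rewrite subr_ge0 ltW//; apply: bdry => //; lra.
  - move=> x s xr ss neg.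
    have [_ [l ul ud]] := sol x s (ltW xr) ltac:(lra).
    exists (l + expR (u x s)), (l - - expR (bubble al x)); split.
    + by apply: der_eq (derB ud (der_cst (bubble al x) s)) _; rewrite subr0.
    + exact: is_lapB ul (bubble_lap al x).
    + have := expR_ge1Dx (u x s - bubble al x).
      have e0 := expR_gt0 (bubble al x).
      have E : expR (bubble al x) * expR (u x s - bubble al x) = expR (u x s).
        by rewrite -expRD addrCA subrr addr0.
      rewrite -(ler_pM2l e0) E.
      have : expR (bubble al x) <= expR al by rewrite ler_expR bubble_le_top.
      nra.
  - by rewrite lexx tt'.
by rewrite subr_ge0.
Qed.

(** On the circle [|x|^2 = 32 exp (- A)] the bubbles of heights [A] and [A - ln 4]
    take the values [A - 2 ln 5] and [A - 2 ln 4]; the first factor is their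
    difference.  The second factor bounds from below the fraction of it that the
    heat equation brings to the centre during the time [32 exp (- A)]. *)
Definition bubble_step : R := (2 * ln 5 - 2 * ln 4) * (1 - 2 * expR (- 2)).

Lemma bubble_step_gt0 : 0 < bubble_step.
Proof.
apply: mulr_gt0.
  have : ln 4 < ln 5 :> R by rewrite ltr_ln ?posrE//; lra.
  lra.
have h : 3 <= expR 2 :> R by have := @expR_ge1Dx R 2; lra.
have : expR (- 2) <= 3^-1 :> R.
  by rewrite expRN lef_pV2 ?posrE// expR_gt0.
lra.
Qed.

(** The difference [u - bubble A] is a nonnegative supersolution of the heat
    equation, and on the circle of squared radius [q] it is at least [h], because
    there [u] is above the bubble of height [A - ln 4].  It is compared with
    [h (1 - exp (- 2 (s - t) / q) (2 - |x|^2 / q))], a subsolution that starts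
    nonpositive and stays at most [h] on the circle. *)
Lemma bubble_gain r t0 T al0 u t :
  bubble_barrier r t0 T al0 u -> t0 <= t -> al0 <= u 0 t - ln 4 ->
  32 * expR (- u 0 t) <= r -> t + 32 * expR (- u 0 t) < T ->
  u 0 t + bubble_step <= u 0 (t + 32 * expR (- u 0 t)).
Proof.
move=> hb t0t; set A := u 0 t; set q := 32 * expR (- A) => Aal qr tT.
have [sol bdry above] := hb.
have q0 : 0 < q by rewrite mulr_gt0// expR_gt0.
have Eq : expR A / 8 * q = 4.
  have : expR A * expR (- A) = 1 by rewrite -expRD subrr expR0.
  rewrite /q; lra.
have l4 : 0 < ln 4 :> R by apply: ln_gt0; lra.
have l42 : ln 4 = 2 * ln 2 :> R.
  have -> : 4 = 2 * 2 :> R by ring.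
  by rewrite lnM ?posrE//; ring.
pose h : R := 2 * ln 5 - 2 * ln 4.
have h0 : 0 < h.
  have : ln 4 < ln 5 :> R by rewrite ltr_ln ?posrE//; lra.
  by rewrite /h; lra.
pose E s : R := h * expR (- (2 / q) * (s - t)).
have E0 s : 0 < E s by rewrite mulr_gt0// expR_gt0.
have dE (s : R) : is_derive s 1 E (- (2 / q) * E s).
  by apply: der_eq (is_derive_expl (- (2 / q)) h t s) _; rewrite /E; ring.
pose z y s := u y s - bubble A y - (h - E s * (2 - q^-1 * sq y)).
have persistA y s : t <= s -> s < T -> sq y <= r -> bubble A y <= u y s.
  by move=> ts sT yr; apply: (bubble_persists hb (t := t)) => //; rewrite -?/A; lra.
have : 0 <= z 0 (t + q).
  apply: (@comparison R 1 q t (t + q) 0 z) => //.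
  - have c1 := @local_solution_within T r q t0 t (t + q) u sol qr t0t tT.
    have c2 := @bubble_within A q t (t + q).
    have c3 : {within @cball R 2 q `*` `[t, t + q]%classic,
        continuous (fun z => h - E z.2 * (2 - q^-1 * sq z.1))}.
      apply: continuous_subspaceT => p; apply: cvgB; first exact: cvg_cst.
      apply: cvgM.
        by apply: (@continuous_time R _ E) => s; exact: der_continuous (dE s).
      apply: cvgB; first exact: cvg_cst.
      apply: cvgM; first exact: cvg_cst.
      by apply: (@continuous_space R _ (@sq R 2)); exact: sq_continuous.
    by move=> p; apply: cvgB; [apply: cvgB; [exact: c1|exact: c2]|exact: c3].
  - move=> y yq; rewrite /z /E subrr mulr0 expR0 mulr1.
    have := persistA y t (lexx _) ltac:(lra) (le_trans yq qr).
    have : q^-1 * sq y <= 1 by rewrite mulrC ler_pdivrMr// mul1r.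
    nra.
  - move=> y s yq ss.
    have := bubble_persists hb (t := t) (t' := s) (y := y) Aal t0t.
    have hA : A - ln 4 <= u 0 t by rewrite -/A; lra.
    move=> /(_ ltac:(lra) ltac:(lra) hA); rewrite yq => /(_ qr).
    rewrite /z yq mulVf ?gt_eqF//.
    have -> : bubble (A - ln 4) y = A - ln 4 - 2 * ln 2.
      rewrite /bubble yq expRB lnK ?posrE//.
      have -> : expR A / 4 / 8 * q = 1 by lra.
      by [].
    have -> : bubble A y = A - 2 * ln 5.
      rewrite /bubble yq Eq; congr (_ - _ * ln _); ring.
    rewrite /h; have := E0 s; lra.
  - move=> y s yq ss _.
    have [_ [l ul ud]] := sol y s (le_trans (ltW yq) qr) ltac:(lra).
    exists (l + expR (u y s) - 0 - (0 - (E s * (0 - 0) + (2 - q^-1 * sq y) * (- (2 / q) * E s)))),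
      (l - - expR (bubble A y) - (0 - E s * (0 - q^-1 * (2 * 2%:R)))); split.
    + exact: (derB (derB ud (der_cst (bubble A y) s)) (derB (der_cst h s)
        (derM (dE s) (derB (der_cst 2 s) (der_cst (q^-1 * sq y) s))))).
    + exact: (is_lapB (is_lapB ul (bubble_lap A y)) (is_lapB (is_lap_cst h y)
        (is_lapZ (E s) (is_lapB (is_lap_cst 2 y) (is_lapZ q^-1 (is_lap_sqE y)))))).
    + have := persistA y s ltac:(lra) ltac:(lra) (le_trans (ltW yq) qr).
      rewrite -ler_expR => h1.
      have qi : 0 < q^-1 by rewrite invr_gt0.
      have : 0 <= q^-1 * (q^-1 * sq y) * E s.
        by rewrite !mulr_ge0 ?sq_ge0// ltW.
      rewrite mul0r addr0; lra.
  - by rewrite sq0 ltW.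
  - by rewrite lexx lerDl ltW.
rewrite /z bubble0 sq0 mulr0 subr0 /E [t + q - t]addrAC subrr add0r.
have -> : - (2 / q) * q = - 2 by field; rewrite gt_eqF.
by rewrite /bubble_step -/h; lra.
Qed.

End bubble_growth.

(** The constant [C = c / (1 - exp (- del))] is the sum of the geometric series of
    waiting times, [C - c = C exp (- del)].  If [T - t] exceeded [C exp (- M t)],
    the steps could be repeated for ever before a time smaller than [T], and [M]
    would be unbounded there. *)
Lemma rate_from_gain (R : realType) (M : R -> R) (t0 T A0 c del : R) :
  0 < c -> 0 < del ->
  (forall t, t0 <= t -> A0 <= M t -> t + c * expR (- M t) < T ->
    M t + del <= M (t + c * expR (- M t))) ->
  (forall t, t < T -> exists B, forall s, t0 <= s <= t -> M s <= B) ->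
  forall t, t0 <= t < T -> A0 <= M t ->
    T - t <= c / (1 - expR (- del)) * expR (- M t).
Proof.
move=> c0 del0 gain bd t /andP[t0t tT] MA; rewrite leNgt; apply/negP => far.
have e1 : expR (- del) < 1 by rewrite -expR0 ltr_expR oppr_lt0.
set C := c / (1 - expR (- del)) in far.
have CE : C - c = C * expR (- del).
  by rewrite /C; field; rewrite subr_eq0 gt_eqF.
have C0 : 0 < C by rewrite divr_gt0// subr_gt0.
pose tau := t + C * expR (- M t).
have tauT : tau < T by rewrite /tau; lra.
have chain k : exists s, [/\ t <= s, s + C * expR (- M s) <= tau & M t + k%:R * del <= M s].
  elim: k => [|k [s [ts stau Ms]]].
    by exists t; rewrite mul0r addr0 !lexx.
  have MA' : A0 <= M s.
    by apply: le_trans MA (le_trans _ Ms); rewrite lerDl mulr_ge0 ?ler0n// ltW.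
  have es := expR_gt0 (- M s).
  have cC : c < C.
    have := mulr_gt0 C0 (expR_gt0 (- del)); lra.
  have cs : c * expR (- M s) <= C * expR (- M s) by rewrite ler_pM2r// ltW.
  have g := gain s ltac:(lra) MA' ltac:(lra).
  set s' := s + c * expR (- M s) in g.
  exists s'; split.
  - have := mulr_gt0 c0 es; rewrite /s'; lra.
  - have : expR (- M s') <= expR (- del) * expR (- M s).
      by rewrite -expRD ler_expR; lra.
    rewrite -(ler_pM2l C0) mulrA -CE => h; rewrite /s'; lra.
  - rewrite -natr1 mulrDl mul1r; lra.
have [B hB] := bd tau tauT.
pose k := Num.bound `|(B - M t) / del|.
have hk : (B - M t) / del < k%:R.
  by apply: le_lt_trans (ler_norm _) _; apply: archi_boundP; exact: normr_ge0.
have [s [ts stau Ms]] := chain k.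
have := hB s; have := mulr_gt0 C0 (expR_gt0 (- M s)) => h1 /(_ ltac:(lra)).
move: hk; rewrite ltr_pdivrMr//; lra.
Qed.

(** * Classical solutions *)

Lemma eball_sq (R : realType) n (r : R) : 0 < r ->
  @eball R n r = [set x | sq x < r ^+ 2].
Proof.
move=> r0; apply/seteqP; split => x; rewrite /eball /= /enorm -/(sq x) => h.
  rewrite -(sqr_sqrtr (sq_ge0 x)) ltr_sqr ?nnegrE ?sqrtr_ge0//; exact: ltW.
rewrite -ltr_sqr ?nnegrE ?sqrtr_ge0// ?ltW//.
by rewrite sqr_sqrtr// sq_ge0.
Qed.

Lemma enorm_sq (R : realType) n (x y : 'rV[R]_n) : sq x = sq y -> enorm x = enorm y.
Proof. by rewrite /enorm -/(sq x) -/(sq y) => ->. Qed.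

Lemma sqZ (R : realType) n (k : R) (x : 'rV[R]_n) : sq (k *: x) = k ^+ 2 * sq x.
Proof.
by rewrite /sq mulr_sumr; apply: eq_bigr => i _; rewrite mxE exprMn.
Qed.

Lemma open_sq_lt (R : realType) n (r : R) : open [set x : 'rV[R]_n | sq x < r].
Proof.
by apply: (open_comp _ (@open_lt _ r)) => x _; exact: sq_continuous.
Qed.

(** Points on the sphere are approached along their radius. *)
Lemma sphere_closure (R : realType) n (r : R) (x : 'rV[R]_n) : 0 < r ->
  sq x <= r -> closure [set x | sq x < r] x.
Proof.
move=> r0 xr B Bx.
have c1 : (fun h : R => (1 - h) *: x) h @[h --> 0] --> x.
  have -> : nbhs x = nbhs ((1 - 0) *: x) by rewrite subr0 scale1r.
  apply: cvgZl.
  by apply: cvgB; [exact: cvg_cst|exact: cvg_id].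
have /nbhs_ballP[e /= e0 be] := c1 _ Bx.
pose h := Num.min (e / 2) (1 / 2).
have h0 : 0 < h by rewrite lt_min !divr_gt0.
have h1 : h <= 1 / 2 by rewrite ge_min lexx orbT.
have he : h <= e / 2 by rewrite ge_min lexx.
exists ((1 - h) *: x); split; last first.
  by apply: be; rewrite /ball /= sub0r normrN gtr0_norm//; lra.
rewrite /= sqZ; have := sq_ge0 x.
have : (1 - h) ^+ 2 < 1 by nra.
have : 0 <= (1 - h) ^+ 2 by exact: sqr_ge0.
nra.
Qed.

Lemma continuous_at_sum (R : realType) (X : topologicalType) n (F : 'I_n -> X -> R) x :
  (forall i, {for x, continuous (F i)}) ->
  {for x, continuous (fun y => \sum_(i < n) F i y)}.
Proof.
elim: n F => [|n IH] F cF.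
  have -> : (fun y => \sum_(i < 0) F i y) = cst 0.
    by apply/funext => y; rewrite big_ord0.
  exact: cvg_cst.
have -> : (fun y => \sum_(i < n.+1) F i y) =
    (fun y => F ord0 y + \sum_(i < n) F (lift ord0 i) y).
  by apply/funext => y; rewrite big_ord_recl.
have cI := IH (fun i => F (lift ord0 i)) (fun i => cF (lift ord0 i)).
exact: (cvgD (cF ord0) cI).
Qed.

Section classical.
Context {R : realType}.
Implicit Types (D : set 'rV[R]_2) (T : R) (u : 'rV[R]_2 -> R -> R).

Lemma classical_at D T (u0 : 'rV[R]_2 -> R) u x t :
  open D -> classical_solution D T u0 u -> D x -> 0 < t < T ->
  [/\ {for (x, t), continuous (fun z => u z.1 z.2)},
    is_lap (u ^~ t) x (laplacian (u ^~ t) x) &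
    is_derive t 1 (u x) (laplacian (u ^~ t) x + expR (u x t))].
Proof.
move=> oD [[uC _] _ ueq _ _] Dx tT; split.
- by have [c _ _ _] := uC; exact: (within_cylinder_at oD c).
- exact: C21_is_lap uC Dx tT.
- have [_ [dt _] _ _] := uC.
  have := dt x t; rewrite /= in_itv/= => /(_ (conj Dx tT)) dut.
  by split => //; rewrite -derive1E ueq.
Qed.

Lemma laplacian_bounded_below D T (u0 : 'rV[R]_2 -> R) u r t :
  open D -> classical_solution D T u0 u ->
  0 < t < T -> 0 <= r -> cball r `<=` D ->
  exists2 k, 0 < k & forall x, sq x <= r -> - k < laplacian (u ^~ t) x.
Proof.
move=> oD [[uC _] _ _ _ _] tT r0 rD.
have c1 (x : 'rV[R]_2) : D x -> {for x, continuous (fun x => laplacian (u ^~ t) x)}.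
  move=> Dx; rewrite /laplacian.
  have ci (i : 'I_2) : {for x, continuous (fun x => partial i (partial i (u ^~ t)) x)}.
    have [_ _ _ d2] := uC; have [_ c] := d2 i i.
    have cx := within_cylinder_at oD c Dx tT.
    apply: (@continuous_comp2 _ _ _ _ id (fun=> t)
      (fun z => partial i (partial i (u ^~ z.2)) z.1) x);
      [exact: cvg_id|exact: (@cst_continuous _ _ t x)|exact: cx].
  exact: (continuous_at_sum ci).
have c2 : {within cball r, continuous (fun x => laplacian (u ^~ t) x)}.
  by apply: continuous_in_subspaceT => x; rewrite inE => /rD; exact: c1.
have [|c _ cmin] := compact_EVT_min _ (@cball_compact R 2 r) c2.
  by exists 0; rewrite /cball /= sq0.
exists (`|laplacian (u ^~ t) c| + 1); first by rewrite ltr_wpDl// normr_ge0.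
move=> x xr; have := cmin x; rewrite inE => /(_ xr).
have := ler_norm (- laplacian (u ^~ t) c); rewrite normrN.
by move: (laplacian (u ^~ t) c) (laplacian (u ^~ t) x) => p q; lra.
Qed.

End classical.

(** * Lower bounds, the barrier and the blow-up rate *)

Section blow_up.
Context {R : realType}.

(** Up to the time [T / 2] the lower bound is part of the notion of solution.  It is
    propagated from there, and not from time zero, because [u] need not be
    continuous where the boundary meets the initial time. *)
Lemma ball_lower_bound (rho T : R) (u0 : 'rV[R]_2 -> R) (u : 'rV[R]_2 -> R -> R) :
  0 < rho -> 0 < T -> classical_solution (eball rho) T u0 u ->
  exists2 C, 0 <= C & forall x t, eball rho x -> 0 < t < T -> - C <= u x t.
Proof.
move=> rho0 T0 sol; have [[_ cu] ub _ ubd _] := sol.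
have r20 : 0 < rho ^+ 2 by rewrite exprn_gt0.
have oD : open (@eball R 2 rho) by rewrite eball_sq//; exact: open_sq_lt.
have clo x : sq x <= rho ^+ 2 -> closure (@eball R 2 rho) x.
  by rewrite eball_sq//; exact: sphere_closure.
have bd x : sq x = rho ^+ 2 -> boundary (@eball R 2 rho) x.
  move=> xr; split; first by apply: clo; rewrite xr.
  by move/interior_subset; rewrite eball_sq//= xr ltxx.
have [M uM] := ub rho (T / 2) ltac:(lra).
have D0 : @eball R 2 rho 0 by rewrite eball_sq//= sq0.
have M0 : 0 <= M.
  have TT : 0 < T / 2 <= T / 2 by lra.
  exact: le_trans (normr_ge0 _) (uM 0 (T / 2) D0 (ltW D0) TT).
have early x t : eball rho x -> 0 < t <= T / 2 -> - M <= u x t.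
  by move=> Dx tt; have := uM x t Dx (ltW Dx) tt; rewrite ler_norml => /andP[].
exists M => // x t Dx /andP[t0 tT].
have [tl|tg] := leP t (T / 2); first by apply: early => //; rewrite t0.
suff : 0 <= u x t + M by lra.
apply: (@comparison R 1 (rho ^+ 2) (T / 2) t 0 (fun x t => u x t + M)) => //.
- have c : {within @cball R 2 (rho ^+ 2) `*` `[T / 2, t]%classic,
      continuous (fun z => u z.1 z.2)}.
    apply: continuous_subspaceW cu => -[y s] [/= yr]; rewrite in_itv/= => st.
    by left; split => /=; [exact: clo|rewrite in_itv/=; lra].
  by move=> p; apply: cvgD; [exact: c|exact: cvg_cst].
- move=> y yr; have [yE|yn] := eqVneq (sq y) (rho ^+ 2).
    by rewrite (ubd y (T / 2) (bd y yE) ltac:(lra)); lra.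
  have Dy : eball rho y by rewrite eball_sq//= lt_neqAle yn.
  by have := early y (T / 2) Dy ltac:(lra); lra.
- by move=> y s yE st; rewrite (ubd y s (bd y yE) ltac:(lra)); lra.
- move=> y s yr st _.
  have Dy : eball rho y by rewrite eball_sq.
  have [_ ul ud] := classical_at (t := s) oD sol Dy ltac:(lra).
  exists (laplacian (u ^~ s) y + expR (u y s) + 0), (laplacian (u ^~ s) y + 0); split.
  + exact: derD ud (der_cst M s).
  + exact: is_lapD ul (is_lap_cst M y).
  + by have := expR_gt0 (u y s); move: (laplacian _ y) => p; lra.
- by apply: ltW; move: Dx; rewrite eball_sq.
- by rewrite ltW//= lexx.
Qed.

Lemma space_lower_bound (T : R) (u0 : 'rV[R]_2 -> R) (u : 'rV[R]_2 -> R -> R) :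
  0 < T -> (forall x, 0 <= u0 x) -> classical_solution setT T u0 u ->
  (forall t, 0 < t < T -> radial setT (u ^~ t)) ->
  (forall t, 0 < t < T -> forall x, u x t <= u 0 t) ->
  forall x t, 0 < t < T -> 0 <= u x t.
Proof.
move=> T0 u00 sol rad umax; have [[uC cu] ub ueq _ ui] := sol.
apply: entire_nonneg.
- split => //; first by move=> x t tT; exact: ueq.
  by move=> t tT x y xy; apply: (rad t tT) => //; exact: enorm_sq.
- by apply: continuous_subspaceW cu => z Qz; right.
- by move=> x; rewrite ui.
- by move=> x t tT; exact: umax.
- move=> t tT; have [M uM] := ub 0 t tT; exists M => s st.
  by apply: uM => //; rewrite /enorm -/(sq _) sq0 sqrtr0.
Qed.

(** The radius and the least height are chosen so that [crossing_ordered] applies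
    from the time [T / 2] on.  With [k] a bound for the negative part of the
    Laplacian, [u + k |x|^2] is subharmonic and hence radially nondecreasing;
    bubbles lose at least [k |x|^2] once [k r <= 1] and [k <= exp al / 8].  The
    other lower bound on [al0] puts the bubbles below [- C] on the boundary
    circle. *)
Lemma exists_bubble_barrier (D : set 'rV[R]_2) (T r0 C : R) (u0 : 'rV[R]_2 -> R)
    (u : 'rV[R]_2 -> R -> R) :
  open D -> 0 < T -> classical_solution D T u0 u -> 0 < r0 -> cball r0 `<=` D ->
  (forall t, 0 < t < T -> radial D (u ^~ t)) ->
  (forall x t, D x -> 0 < t < T -> - C <= u x t) ->
  exists r al0, 0 < r /\ bubble_barrier r (T / 2) T al0 u.
Proof.
move=> oD T0 sol r00 rD rad low.
have [k k0 lapk] := laplacian_bounded_below (t := T / 2) oD sol ltac:(lra) (ltW r00) rD.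
pose r := Num.min r0 k^-1.
have r_gt0 : 0 < r by rewrite lt_min r00 invr_gt0.
have rr0 : r <= r0 by rewrite ge_min lexx.
have rk : r <= k^-1 by rewrite ge_min lexx orbT.
have inD x : sq x <= r -> D x by move=> xr; apply: rD; exact: le_trans rr0.
pose al0 := Num.max (ln (8 * k)) (C - 2 * ln (r / 8) + 1).
have al1 : ln (8 * k) <= al0 by rewrite le_max lexx.
have al2 : C - 2 * ln (r / 8) + 1 <= al0 by rewrite le_max lexx orbT.
have loc : local_solution r (T / 2) T u.
  move=> x t xr tt.
  have [c l d] := classical_at (t := t) oD sol (inD x xr) ltac:(lra).
  by split => //; exists (laplacian (u ^~ t) x).
have radr x y t : sq x <= r -> T / 2 <= t < T -> sq x = sq y -> u x t = u y t.
  move=> xr tt xy; apply: (rad t ltac:(lra) x y); [exact: inD| |exact: enorm_sq].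
  by apply: inD; rewrite -xy.
have bdry al x t : al0 <= al -> sq x = r -> T / 2 <= t < T -> bubble al x < u x t.
  move=> alal xr tt; have := low x t (inD x ltac:(by rewrite xr)) ltac:(lra).
  have : al + ln (r / 8) <= ln (1 + expR al / 8 * r).
    have e0 := expR_gt0 al.
    rewrite -[X in X + _](expRK al) -lnM ?posrE ?divr_gt0//.
    rewrite ler_ln ?posrE; first by lra.
      by rewrite mulr_gt0 ?divr_gt0.
    by apply: bubble_arg_gt0; exact: ltW.
  rewrite /bubble xr; lra.
exists r, al0; split => //; split => // al t y alal tt alu yr.
suff : Num.min (u 0 t - bubble al 0) 0 <= u y t - bubble al y.
  by rewrite bubble0 min_r ?subr_ge0.
apply: (crossing_ordered loc radr _ _ tt _ yr).
- by move=> x s; exact: bdry.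
- move=> x1 y1 xy y1r.
  have mono : u x1 (T / 2) + k * sq x1 <= u y1 (T / 2) + k * sq y1.
    apply: (@radial_subharmonic_ndecr R 1 r (fun x => u x (T / 2) + k * sq x)) => //.
    - apply: continuous_in_subspaceT => x; rewrite inE => xr.
      have [c _] := loc x (T / 2) xr ltac:(lra).
      have c1 : {for x, continuous (fun y => u y (T / 2))}.
        apply: (@continuous_comp2 _ _ _ _ id (fun=> T / 2) (fun z => u z.1 z.2) x);
          [exact: cvg_id|exact: (@cst_continuous _ _ (T / 2) x)|exact: c].
      exact: (cvgD c1 (cvgM (@cvg_cst _ k _ (nbhs x) _) (@sq_continuous R 2 x))).
    - by move=> x z xr xz; rewrite (radr x z _ xr _ xz) ?xz//; lra.
    - move=> x xr; have [_ ul _] := classical_at (t := T / 2) oD sol (inD x (ltW xr)) ltac:(lra).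
      exists (laplacian (u ^~ (T / 2)) x + k * (2 * 2%:R)).
        exact: is_lapD ul (is_lapZ k (is_lap_sqE x)).
      have := lapk x (le_trans (ltW xr) rr0).
      by move: (laplacian _ x) => p; lra.
  have := bubble_steep al xy y1r; set c := expR al / 8.
  have ck : k <= c.
    have : ln (8 * k) <= al by lra.
    rewrite -ler_expR lnK ?posrE ?mulr_gt0// /c; lra.
  have c0 : 0 < c by rewrite divr_gt0// expR_gt0.
  have kr : k * r <= 1 by rewrite mulrC -ler_pdivlMr// mul1r.
  have h : k <= 2 * c / (1 + c * r).
    rewrite ler_pdivlMr; last by rewrite ltr_wpDr// mulr_ge0// ltW.
    have : c * (k * r) <= c * 1 by rewrite ler_pM2l.
    lra.
  have := ler_wpM2r (_ : 0 <= sq y1 - sq x1) h; rewrite subr_ge0 => /(_ xy).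
  lra.
- by rewrite sq0 sq_ge0.
Qed.

(** At a spatial maximum diffusion can only slow the growth down, so the
    derivative of [exp (- u 0)] is at least [- 1]. *)
Lemma max_growth_le (D : set 'rV[R]_2) (T : R) (u0 : 'rV[R]_2 -> R)
    (u : 'rV[R]_2 -> R -> R) (s t : R) :
  open D -> D 0 -> classical_solution D T u0 u ->
  (forall t, 0 < t < T -> forall x, D x -> u x t <= u 0 t) ->
  0 < s -> s <= t -> t < T ->
  expR (- u 0 s) - (t - s) <= expR (- u 0 t).
Proof.
move=> oD D0 sol umax s0; rewrite le_eqVlt => /predU1P[->|st] tT.
  by rewrite subrr subr0.
pose df r := expR (- u 0 r) * - (laplacian (u ^~ r) 0 + expR (u 0 r)).
have dE (r : R) : 0 < r < T -> is_derive r 1 (fun r => expR (- u 0 r)) (df r).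
  by move=> rT; have [_ _ d] := classical_at (t := r) oD sol D0 rT; exact: (der_exp (derN d)).
have [||c] := @MVT R (fun r => expR (- u 0 r)) df s t st.
- by move=> r; rewrite in_itv/= => /andP[sr rt]; apply: dE; lra.
- apply: derivable_within_continuous => r; rewrite in_itv/= => /andP[sr rt].
  by have [] : is_derive r 1 (fun r => expR (- u 0 r)) (df r) by apply: dE; lra.
rewrite in_itv/= => /andP[sc ct] E.
have cT : 0 < c < T by lra.
have [_ l _] := classical_at (t := c) oD sol D0 cT.
have l0 : laplacian (u ^~ c) 0 <= 0.
  apply: is_lap_max l _; move: oD; rewrite openE => /(_ _ D0).
  by rewrite /interior /=; apply: filterS => x; exact: umax.
have : - 1 <= df c.
  have : expR (- u 0 c) * expR (u 0 c) = 1 by rewrite -expRD addNr expR0.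
  have := expR_gt0 (- u 0 c); rewrite /df.
  by move: l0; move: (laplacian _ 0) => p; nra.
move=> h; have : - 1 * (t - s) <= df c * (t - s) by rewrite ler_wpM2r// subr_ge0 ltW.
lra.
Qed.

End blow_up.

Theorem theorem4 (R : realType) (Omega : set 'rV[R]_2) (T : R)
    (u0 : 'rV[R]_2 -> R) (u : 'rV[R]_2 -> R -> R)
    (Omega_def : (exists2 rho : R, 0 < rho & Omega = eball rho) \/
                 Omega = setT)
    (T_gt0 : 0 < T)
    (u0_C1 : C1_closure Omega u0)
    (u0_ge0 : forall x, Omega x -> 0 <= u0 x)
    (u_sol : classical_solution Omega T u0 u)
    (u_radial : forall t, 0 < t < T -> radial Omega (u ^~ t))
    (u_max : forall t, 0 < t < T -> forall x, Omega x -> u x t <= u 0 t)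
    (u_blowup : blows_up_at Omega T u) :
  type_I Omega T u.
Proof.
have [oD D0 [r0 r00 r0D] [C C0 low]] : [/\ open Omega, Omega 0,
    exists2 r0, 0 < r0 & cball r0 `<=` Omega &
    exists2 C, 0 <= C & forall x t, Omega x -> 0 < t < T -> - C <= u x t].
  case: Omega_def => [[rho rho0 E]|E]; subst Omega.
    have r20 : 0 < rho ^+ 2 by rewrite exprn_gt0.
    split; [rewrite eball_sq//; exact: open_sq_lt|by rewrite eball_sq//= sq0| |].
      exists (rho ^+ 2 / 2); first by rewrite divr_gt0.
      by rewrite eball_sq// => x; rewrite /cball/=; lra.
    exact: ball_lower_bound rho0 T_gt0 u_sol.
  split; [exact: openT|by []|by exists 1|].
  exists 0 => // x t _ tT; rewrite oppr0.
  apply: (space_lower_bound T_gt0 _ u_sol u_radial _ x tT) => [y|s sT y].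
    exact: u0_ge0.
  exact: u_max.
have [_ ub _ _ _] := u_sol.
have bd t : t < T -> exists B, forall s, 0 < s <= t -> `|u 0 s| <= B.
  move=> tT; have [B uB] := ub 0 t tT; exists B => s st.
  by apply: uB => //; rewrite /enorm -/(sq _) sq0 sqrtr0.
have sup_le t K : 0 < t < T -> u 0 t <= K -> C <= K -> (supnorm Omega (u ^~ t) <= K%:E)%E.
  move=> tT uK CK; apply: ge_ereal_sup => _ [x Dx <-]; rewrite lee_fin ler_norml.
  by apply/andP; split; [have := low x t Dx tT; lra|exact: le_trans (u_max t tT x Dx) uK].
have sup_ge t : ((u 0 t)%:E <= supnorm Omega (u ^~ t))%E.
  apply: le_ereal_sup_tmp; exists (`|u 0 t|)%:E; first by exists 0.
  by rewrite lee_fin ler_norm.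
have lower t : 0 < t < T -> - ln (T - t) <= u 0 t.
  move=> /andP[t0 tT]; rewrite leNgt; apply/negP => small.
  have far : T - t < expR (- u 0 t).
    by rewrite -[X in X < _]lnK ?posrE ?subr_gt0// ltr_expR; lra.
  pose ka := expR (- u 0 t) - (T - t); have ka0 : 0 < ka by rewrite /ka; lra.
  pose K := Num.max (- ln ka) C.
  have [_] := u_blowup; apply/eqP; rewrite lt_eqF// (le_lt_trans _ (ltry K))//.
  rewrite limf_esupE; apply: ge_ereal_inf.
  exists (ereal_sup [set supnorm Omega (u ^~ s) | s in [set s | t < s < T]]).
    exists [set s | t < s < T] => //.
    near=> s; apply/andP; split; near: s; [exact: nbhs_left_gt|exact: nbhs_left_lt].
  apply: ge_ereal_sup => _ [s /= /andP[ts sT] <-]; apply: sup_le.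
  - by rewrite (lt_trans t0 ts).
  - rewrite /K le_max; apply/orP; left.
    have := max_growth_le oD D0 u_sol u_max t0 (ltW ts) sT => h.
    have : ka <= expR (- u 0 s) by rewrite /ka; lra.
    by rewrite -[X in X <= _]lnK ?posrE// ler_expR; lra.
  - by rewrite /K le_max lexx orbT.
have [r [al0 [r_gt0 bar]]] := exists_bubble_barrier oD T_gt0 u_sol r00 r0D u_radial low.
pose A0 := Num.max (al0 + ln 4) (- ln (r / 32)).
have A1 : al0 + ln 4 <= A0 by rewrite le_max lexx.
have A2 : - ln (r / 32) <= A0 by rewrite le_max lexx orbT.
have rate := @rate_from_gain R (fun t => u 0 t) (T / 2) T A0 32 bubble_step.
have {rate} rate : forall t, T / 2 <= t < T -> A0 <= u 0 t ->
    T - t <= 32 / (1 - expR (- bubble_step)) * expR (- u 0 t).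
  apply: rate => //; first exact: bubble_step_gt0.
    move=> t t0 At tT; apply: (bubble_gain bar) => //; first lra.
    have : expR (- u 0 t) <= r / 32.
      by rewrite -[leRHS]lnK ?posrE ?divr_gt0// ler_expR; lra.
    lra.
  move=> t tT; have [B hB] := bd t tT; exists B => s st.
  by apply: le_trans (ler_norm _) (hB s ltac:(lra)).
set C' := 32 / _ in rate.
have C'0 : 0 < C'.
  by rewrite divr_gt0// subr_gt0 -expR0 ltr_expR oppr_lt0; exact: bubble_step_gt0.
have [B hB] := bd (T / 2) ltac:(lra).
pose C2 := `|ln C'| + `|ln T| + `|B| + `|A0| + C.
exists 0, C2 => t /andP[t0 tT].
have tT' : 0 < t < T by rewrite t0.
have Tt0 : 0 < T - t by lra.
apply/andP; split.
  apply: (@le_trans _ _ ((ln (T - t))%:E + (u 0 t)%:E)%E).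
    by rewrite -EFinD lee_fin; have := lower t tT'; lra.
  by rewrite leeD2l// sup_ge.
have lnT : ln (T - t) <= `|ln T|.
  apply: le_trans (ler_norm _); rewrite ler_ln ?posrE//; lra.
have n1 := normr_ge0 (ln C'); have n2 := normr_ge0 B; have n3 := normr_ge0 A0.
have n4 := normr_ge0 (ln T).
have main : ln (T - t) + Num.max (u 0 t) C <= C2.
  have -> : ln (T - t) + Num.max (u 0 t) C =
      Num.max (ln (T - t) + u 0 t) (ln (T - t) + C) by rewrite addr_maxr.
  rewrite ge_max; apply/andP; split; last by rewrite /C2; lra.
  have [th|th] := leP t (T / 2).
    have := hB t ltac:(lra); have := ler_norm (u 0 t); have := ler_norm B.
    rewrite /C2; lra.
  have [uA|uA] := leP A0 (u 0 t).
    have h : ln (T - t) <= ln (C' * expR (- u 0 t)).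
      rewrite ler_ln ?posrE//; last by rewrite mulr_gt0// expR_gt0.
      by apply: rate => //; lra.
    move: h; rewrite lnM ?posrE ?expR_gt0// expRK.
    by have := ler_norm (ln C'); rewrite /C2; lra.
  by have := ler_norm A0; rewrite /C2; lra.
apply: (@le_trans _ _ ((ln (T - t))%:E + (Num.max (u 0 t) C)%:E)%E); last first.
  by rewrite -EFinD lee_fin.
rewrite leeD2l//; apply: sup_le => //; by rewrite le_max lexx ?orbT.
Unshelve. all: by end_near. Qed.
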